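(* Let $\Phi=\{\varphi_\nu\}_{\nu=1}^\infty\subset\mathcal A(\mathbb R^n)$ be a family satisfying: for each $\nu\in\mathbb N$ and each $A>0$ there is a constant $C_{\nu,A}>0$ such that $\varphi_\nu(x)+A\ln(1+\|x\|)\le\varphi_{\nu+1}(x)+C_{\nu,A}$ for all $x\in\mathbb R^n$. Then for each $f\in E(\Phi)$ the restriction of $f$ to $\mathbb R^n$ belongs to $\mathcal E(\Psi^* )$.
   Context: Let $n\in\mathbb N$; $\mathbb Z_+=\{0,1,2,\dots\}$; $\|\cdot\|$ is the Euclidean norm on $\mathbb R^n$ and $\mathbb C^n$; $\langle u,v\rangle=u_1v_1+\cdots+u_nv_n$; for $z\in\mathbb C^n$, $\operatorname{Im}z=(\operatorname{Im}z_1,\dots,\operatorname{Im}z_n)$; $H(\mathbb C^n)$ is the space of entire functions on $\mathbb C^n$. Standard multi-index notation is used ($\alpha!=\alpha_1!\cdots\alpha_n!$, $D^\alpha=\partial^{|\alpha|}/\partial x_1^{\alpha_1}\cdots\partial x_n^{\alpha_n}$). $\mathcal A(\mathbb R^n)$ is the set of all real-valued $g\in C(\mathbb R^n)$ such that: 1) $g(x)=g(|x_1|,\dots,|x_n|)$ for all $x\in\mathbb R^n$; 2) the restriction of $g$ to $[0,\infty)^n$ is nondecreasing in each variable; 3) $\lim_{x\to\infty}g(x)/\|x\|=+\infty$. For $g:\mathbb R^n\to[-\infty,+\infty]$ the Young-Fenchel conjugate is $g^*(x)=\sup_{y\in\mathbb R^n}(\langle x,y\rangle-g(y))$, $x\in\mathbb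 R^n$. Put $\psi_\nu(x)=\varphi_\nu(e^{x_1},\dots,e^{x_n})$ for $x\in\mathbb R^n$. $E(\Phi)=\bigcup_{\nu\ge1}E(\varphi_\nu)$, where $E(\varphi_\nu)$ is the set of all $f\in H(\mathbb C^n)$ such that for every $m\in\mathbb Z_+$ $$p_{\nu,m}(f)=\sup_{z\in\mathbb C^n}\frac{|f(z)|(1+\|z\|)^m}{e^{\varphi_\nu(\operatorname{Im}z)}}<\infty.$$ $\mathcal E(\Psi^* )=\bigcup_{\nu\ge1}\mathcal E(\psi_\nu^* )$, where $\mathcal E(\psi_\nu^* )$ is the set of all (complex-valued) $f\in C^\infty(\mathbb R^n)$ such that for every $m\in\mathbb Z_+$ $$\rho_{m,\nu}(f)=\sup_{x\in\mathbb R^n,\ \alpha\in\mathbb Z_+^n}\frac{(1+\|x\|)^m|(D^\alpha f)(x)|}{\alpha!\,e^{-\psi_\nu^*(\alpha)}}<\infty.$$ *)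

(* Defs.v *)
From HB Require Import structures.
From mathcomp Require Import all_boot all_order all_algebra.
From mathcomp Require Import all_classical all_reals all_analysis.
From mathcomp Require Import complex.

Set Implicit Arguments.
Unset Strict Implicit.
Unset Printing Implicit Defensive.

Import Order.TTheory GRing.Theory Num.Theory.
Import numFieldNormedType.Exports.

Local Open Scope classical_set_scope.
Local Open Scope complex_scope.
Local Open Scope ring_scope.

(* R^n is 'rV[R]_n and C^n is 'rV[R[i]^o]_n.  The alias R[i]^o (convertible to
   R[i]) is what carries the topology and the R[i]-normed-module structure of
   the complex plane, so that differentiability below is complex. *)

Definition dotp (R : realType) (n : nat) (u v : 'rV[R]_n) : R :=
  \sum_(i < n) u ord0 i * v ord0 i.

(* The library norm on row vectors is the sup norm, and `|w| for w : R[i] has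
   type R[i]; hence the Euclidean norms and the R-valued modulus normc. *)
Definition enorm (R : realType) (n : nat) (x : 'rV[R]_n) : R :=
  Num.sqrt (\sum_(i < n) `|x ord0 i| ^+ 2).

Definition cmod (R : realType) (w : R[i]) : R := ComplexField.Normc.normc w.

Definition cnorm (R : realType) (n : nat) (z : 'rV[R[i]^o]_n) : R :=
  Num.sqrt (\sum_(i < n) cmod (z ord0 i) ^+ 2).

Definition imv (R : realType) (n : nat) (z : 'rV[R[i]^o]_n) : 'rV[R]_n :=
  \row_(i < n) complex.Im (z ord0 i).

Definition to_cvec (R : realType) (n : nat) (x : 'rV[R]_n) : 'rV[R[i]^o]_n :=
  \row_(i < n) (x ord0 i)%:C.

Definition restrict_real (R : realType) (n : nat)
    (f : 'rV[R[i]^o]_n -> R[i]^o) : 'rV[R]_n -> R[i] :=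
  fun x => f (to_cvec x).

(* The filter of neighbourhoods of infinity in R^n. *)
Definition at_infinity (R : realType) (n : nat) : set_system 'rV[R]_n :=
  filter_from [set: R] (fun r => [set x : 'rV[R]_n | r < enorm x]).

Definition class_A (R : realType) (n : nat) : set ('rV[R]_n -> R) :=
  [set g : 'rV[R]_n -> R | [/\ continuous g,
     (forall x : 'rV[R]_n, g x = g (\row_(i < n) `|x ord0 i|)),
     (forall (i : 'I_n) (x y : 'rV[R]_n),
        (forall j, 0 <= x ord0 j) ->
        (forall j, j != i -> y ord0 j = x ord0 j) ->
        x ord0 i <= y ord0 i -> g x <= g y) &
     g x / enorm x @[x --> @at_infinity R n] --> +oo]].

Definition young_fenchel (R : realType) (n : nat) (g : 'rV[R]_n -> \bar R)
    (x : 'rV[R]_n) : \bar R :=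
  ereal_sup (range (fun y : 'rV[R]_n => ((dotp x y)%:E - g y)%E)).

Definition comp_exp (R : realType) (n : nat) (phi : 'rV[R]_n -> R) :
    'rV[R]_n -> R :=
  fun x => phi (\row_(i < n) expR (x ord0 i)).

Definition entire (R : realType) (n : nat) (f : 'rV[R[i]^o]_n -> R[i]^o) :
    Prop :=
  forall z, differentiable f z.

Definition p_norm (R : realType) (n : nat) (phi : 'rV[R]_n -> R) (m : nat)
    (f : 'rV[R[i]^o]_n -> R[i]^o) : \bar R :=
  ereal_sup (range (fun z : 'rV[R[i]^o]_n =>
    (cmod (f z) * (1 + cnorm z) ^+ m / expR (phi (imv z)))%:E)).

Definition E_space (R : realType) (n : nat) (phi : 'rV[R]_n -> R) :
    set ('rV[R[i]^o]_n -> R[i]^o) :=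
  [set f | entire f /\ forall m : nat, (p_norm phi m f < +oo)%E].

(* Families are indexed by the integers nu >= 1; the value at 0 is ignored. *)
Definition E_Phi (R : realType) (n : nat) (phi : nat -> 'rV[R]_n -> R) :
    set ('rV[R[i]^o]_n -> R[i]^o) :=
  \bigcup_(nu in [set nu : nat | (1 <= nu)%N]) E_space (phi nu).

(* R[i] has no canonical structure of topological R-module, so derivatives of
   complex-valued functions of real variables are taken componentwise. *)
Definition partial (R : realType) (n : nat) (i : 'I_n) (g : 'rV[R]_n -> R[i]) :
    'rV[R]_n -> R[i] :=
  fun x => 'D_(delta_mx ord0 i) (fun y => complex.Re (g y)) x
        +i* 'D_(delta_mx ord0 i) (fun y => complex.Im (g y)) x.

Definition has_partial (R : realType) (n : nat) (i : 'I_n)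
    (g : 'rV[R]_n -> R[i]) (x : 'rV[R]_n) : Prop :=
  derivable (fun y => complex.Re (g y)) x (delta_mx ord0 i) /\
  derivable (fun y => complex.Im (g y)) x (delta_mx ord0 i).

(* All iterated partial derivatives, in any order, exist and are continuous. *)
Definition smooth (R : realType) (n : nat) (g : 'rV[R]_n -> R[i]) : Prop :=
  forall s : seq 'I_n,
    continuous (foldr (@partial R n) g s : 'rV[R]_n -> R[i]^o) /\
    forall (i : 'I_n) (x : 'rV[R]_n), has_partial i (foldr (@partial R n) g s) x.

Definition Dalpha (R : realType) (n : nat) (alpha : 'I_n -> nat)
    (g : 'rV[R]_n -> R[i]) : 'rV[R]_n -> R[i] :=
  foldr (fun i h => iter (alpha i) (partial i) h) g (enum 'I_n).

Definition mfact (n : nat) (alpha : 'I_n -> nat) : nat :=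
  (\prod_(i < n) (alpha i)`!)%N.

Definition mvec (R : realType) (n : nat) (alpha : 'I_n -> nat) : 'rV[R]_n :=
  \row_(i < n) (alpha i)%:R.

(* h is a conjugate psi^*, a priori extended-real valued. *)
Definition rho_norm (R : realType) (n : nat) (h : 'rV[R]_n -> \bar R) (m : nat)
    (g : 'rV[R]_n -> R[i]) : \bar R :=
  ereal_sup (range (fun xa : 'rV[R]_n * ('I_n -> nat) =>
    (((1 + enorm xa.1) ^+ m * cmod (Dalpha xa.2 g xa.1))%:E /
     ((mfact xa.2)%:R%:E * expeR (- h (mvec R xa.2))))%E)).

Definition calE_space (R : realType) (n : nat) (h : 'rV[R]_n -> \bar R) :
    set ('rV[R]_n -> R[i]) :=
  [set g | smooth g /\ forall m : nat, (rho_norm h m g < +oo)%E].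

Definition calE_Psi (R : realType) (n : nat) (phi : nat -> 'rV[R]_n -> R) :
    set ('rV[R]_n -> R[i]) :=
  \bigcup_(nu in [set nu : nat | (1 <= nu)%N])
    calE_space (young_fenchel (fun x => (comp_exp (phi nu) x)%:E)).

(* Main.v *)
Require Import Defs.
From HB Require Import structures.
From mathcomp Require Import all_boot all_order all_algebra.
From mathcomp Require Import all_classical all_reals all_analysis.
From mathcomp Require Import complex ring lra.

Import Order.TTheory GRing.Theory Num.Theory.
Import numFieldNormedType.Exports.
Local Open Scope classical_set_scope.
Local Open Scope ring_scope.

Set Implicit Arguments.
Unset Strict Implicit.
Unset Printing Implicit Defensive.

(** The proof is Cauchy's estimate on polydiscs, followed by an optimization
over the radii.

Let f be in E(phi_nu) and let r_i = exp(y_i) be arbitrary positive radii.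
Cauchy's estimate (polydisc_estimate) bounds |D^alpha f (x)| by
alpha! / r^alpha times the supremum of |f| over the polydisc of radii r
centred at the real point x.  For zeta in that polydisc |Im zeta_i| <= r_i, so
symmetry and monotonicity of phi_nu give phi_nu(Im zeta) <= phi_nu(r)
(class_A_le), while 1 + |x| <= 2 (1 + |zeta|) (1 + |r|) (enorm_polydisc).
Hence
  (1 + |x|)^m |D^alpha f (x)| <= P 2^m alpha! r^-alpha (1 + |r|)^m e^(phi_nu(r)),
and the growth hypothesis replaces (1 + |r|)^m e^(phi_nu(r)) by a multiple of
e^(phi_(nu+1)(r)).  As r^-alpha = e^(-<alpha, y>), taking the infimum over y
turns e^(-(<alpha, y> - psi_(nu+1)(y))) into e^(-psi_(nu+1)^*(alpha)), with
psi_(nu+1)^* the conjugate (young_fenchel_bound).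

The constant alpha! / r^alpha has to be sharp up to a factor independent of
alpha, and f is only assumed complex differentiable at each point, so the
function theory starts from Goursat's theorem.
 - goursat: the boundary integral of an entire function of one variable over a
   rectangle vanishes.
 - periodic_mean: consequently an entire function q of period 2 pi i that tends
   to L at the left end of its period strip has mean L over every vertical
   period.
 - With q(w) = g(c e^w) this is the mean value property (coefint0), and with
   q(w) = (g(e^w) - g(0)) e^(-w) it is Cauchy's formula for g'(0) at the centre
   of the circle (coefint1).
 - Cauchy's formula exhibits the partial derivative of a function of several
   variables as an integral of the function itself; by compactness of the
   circle it is again jointly continuous and separately holomorphic
   (sep_holo_cauchyD), so all iterated derivatives exist and are continuous.
 - Integration by parts on the circle (coefintS) raises the order one step at
   a time, giving the m-th derivative with its exact constant m! / r^m
   (coefint_iter, cauchy_estimate).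
On the real subspace the real partial derivatives of f are the restrictions of
its complex ones (partial_restrict), which gives smoothness. *)

(** * The modulus on the complex plane *)

Section ComplexPlane.
Variable R : realType.
Implicit Types (z w h L : R[i]) (e x t : R).

Lemma cmodM z w : cmod (z * w) = cmod z * cmod w.
Proof. exact: ComplexField.Normc.normcM. Qed.

Lemma cmodN z : cmod (- z) = cmod z.
Proof. exact: (@normcN R). Qed.

Lemma ler_cmodD z w : cmod (z + w) <= cmod z + cmod w.
Proof. exact: (@le_normcD R). Qed.

Lemma ler_cmodB z w : cmod (z - w) <= cmod z + cmod w.
Proof. by rewrite -(cmodN w); exact: ler_cmodD. Qed.

Lemma cmod0 : cmod (0 : R[i]) = 0.
Proof. exact: ComplexField.Normc.normc0. Qed.

Lemma cmod1 : cmod (1 : R[i]) = 1.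
Proof. exact: ComplexField.Normc.normc1. Qed.

Lemma cmodE z : cmod z = Num.sqrt (complex.Re z ^+ 2 + complex.Im z ^+ 2).
Proof. by case: z. Qed.

Lemma cmod_ge0 z : 0 <= cmod z.
Proof. by rewrite cmodE sqrtr_ge0. Qed.

Lemma cmod_eq0 z : cmod z = 0 -> z = 0.
Proof. exact: ComplexField.Normc.eq0_normc. Qed.

Lemma cmod_real x : cmod (x%:C)%C = `|x|.
Proof. by rewrite cmodE /= expr0n addr0 sqrtr_sqr. Qed.

Lemma cmod_i : cmod ('i%C : R[i]) = 1.
Proof. by rewrite cmodE /= expr0n add0r expr1n sqrtr1. Qed.

Lemma ler_Re_cmod z : `|complex.Re z| <= cmod z.
Proof. by rewrite cmodE -sqrtr_sqr ler_wsqrtr// lerDl sqr_ge0. Qed.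

Lemma ler_Im_cmod z : `|complex.Im z| <= cmod z.
Proof. by rewrite cmodE -sqrtr_sqr ler_wsqrtr// lerDr sqr_ge0. Qed.

Lemma ler_cmod_ReIm z : cmod z <= `|complex.Re z| + `|complex.Im z|.
Proof.
rewrite {1}[z]complexE.
have := ler_cmodD (complex.Re z)%:C%C ('i%C * (complex.Im z)%:C%C).
by rewrite cmodM cmod_i mul1r !cmod_real.
Qed.

Lemma normC_cmod z : `|z| = ((cmod z)%:C)%C.
Proof. by rewrite normc_def cmodE. Qed.

End ComplexPlane.

(** * Complex derivatives *)

(** An explicit epsilon-delta form, in terms of the real-valued modulus, so that
    it can be combined with bounds on real integrals and on real and imaginary
    parts. *)
Definition cderiv (R : realType) (g : R[i] -> R[i]) (z L : R[i]) : Prop :=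
  forall e : R, 0 < e -> exists2 d : R, 0 < d &
    forall h, cmod h < d -> cmod (g (z + h) - g z - L * h) <= e * cmod h.

Section ComplexDerivative.
Variable R : realType.
Implicit Types (f g : R[i] -> R[i]) (z w h a b L M : R[i]) (e d x t : R).

Lemma cderiv_lip g z L : cderiv g z L -> exists2 d, 0 < d &
  forall h, cmod h < d -> cmod (g (z + h) - g z) <= (cmod L + 1) * cmod h.
Proof.
move=> /(_ _ ltr01)[d d0 H]; exists d => // h /H gh.
rewrite -(subrK (L * h) (g (z + h) - g z)) mulrDl addrC -cmodM.
by apply: le_trans (ler_cmodD _ _) _; rewrite lerD2l.
Qed.

Lemma cderiv_cst a z : cderiv (fun=> a) z 0.
Proof.
move=> e e0; exists 1 => // h _.
by rewrite subrr mul0r subrr cmod0 mulr_ge0 ?cmod_ge0 ?ltW.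
Qed.

Lemma cderiv_affine a b z : cderiv (fun w => a * w + b) z a.
Proof.
move=> e e0; exists 1 => // h _.
rewrite (_ : _ - _ - _ = 0) ?cmod0 ?mulr_ge0 ?cmod_ge0 ?ltW//; ring.
Qed.

Lemma cderivD f g z L M : cderiv f z L -> cderiv g z M ->
  cderiv (fun w => f w + g w) z (L + M).
Proof.
move=> df dg e e0; have e20 : 0 < e / 2 by rewrite divr_gt0.
have [d1 d10 H1] := df _ e20; have [d2 d20 H2] := dg _ e20.
exists (Num.min d1 d2); first by rewrite lt_min d10.
move=> h; rewrite lt_min => /andP[/H1 h1 /H2 h2].
rewrite (_ : _ - _ - _ = (f (z + h) - f z - L * h) + (g (z + h) - g z - M * h));
  last by ring.
apply: le_trans (ler_cmodD _ _) _.
by apply: le_trans (lerD h1 h2) _; rewrite -mulrDl -splitr.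
Qed.

(** The error of a product is f(z) times the error of g, plus g(z+h) times the
    error of f, plus the cross term L h (g(z+h) - g(z)), which is quadratic. *)
Lemma cderivM f g z L M : cderiv f z L -> cderiv g z M ->
  cderiv (fun w => f w * g w) z (L * g z + f z * M).
Proof.
move=> df dg e e0.
have [dl dl0 Hl] := cderiv_lip dg.
(* The three error terms are at most e / K times |h| times the first three
   summands of K. *)
pose K := cmod (f z) + (cmod (g z) + cmod M + 1) + cmod L * (cmod M + 1) + 1.
have [a0 b0 c0 d0] : [/\ 0 <= cmod (f z), 0 <= cmod (g z), 0 <= cmod L & 0 <= cmod M].
  by split; exact: cmod_ge0.
have K0 : 0 < K by rewrite /K; have := mulr_ge0 c0 d0; nra.
have eK0 : 0 < e / K by rewrite divr_gt0.
have [d1 d10 H1] := df _ eK0; have [d2 d20 H2] := dg _ eK0.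
pose dm := Num.min (Num.min d1 d2) (Num.min dl (Num.min 1 (e / K))).
exists dm; first by rewrite !lt_min d10 d20 dl0 ltr01.
move=> h; rewrite !lt_min => /andP[/andP[/H1 h1 /H2 h2]].
move=> /andP[/Hl hl /andP[hlt1 hltK]].
rewrite (_ : _ - _ - _ = f z * (g (z + h) - g z - M * h)
   + g (z + h) * (f (z + h) - f z - L * h) + L * h * (g (z + h) - g z)); last by ring.
have gh : cmod (g (z + h)) <= cmod (g z) + cmod M + 1.
  rewrite -(subrK (g z) (g (z + h))) addrC -addrA.
  apply: le_trans (ler_cmodD _ _) _; rewrite lerD2l; apply: le_trans hl _.
  by rewrite ler_piMr ?addr_ge0// ltW.
have h0 := cmod_ge0 h.
have T1 : cmod (f z * (g (z + h) - g z - M * h)) <= cmod (f z) * (e / K * cmod h).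
  by rewrite cmodM ler_wpM2l.
have T2 : cmod (g (z + h) * (f (z + h) - f z - L * h))
   <= (cmod (g z) + cmod M + 1) * (e / K * cmod h).
  by rewrite cmodM ler_pM ?cmod_ge0.
have T3 : cmod (L * h * (g (z + h) - g z)) <= cmod L * (cmod M + 1) * (e / K * cmod h).
  rewrite !cmodM -!mulrA ler_wpM2l//.
  have : cmod h * cmod (g (z + h) - g z) <= e / K * ((cmod M + 1) * cmod h).
    by rewrite ler_pM ?cmod_ge0// ltW.
  by move=> /le_trans; apply; rewrite le_eqVlt; apply/orP; left; apply/eqP; ring.
apply: le_trans (ler_cmodD _ _) _; apply: le_trans (lerD (ler_cmodD _ _) T3) _.
apply: le_trans (lerD (lerD T1 T2) (lexx _)) _.
rewrite -!mulrDl mulrA ler_wpM2r// mulrCA ler_piMr ?ltW//.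
by rewrite ltr_pdivrMr// mul1r /K ltrDl.
Qed.

Lemma cderiv_comp f g z L M : cderiv g z M -> cderiv f (g z) L ->
  cderiv (fun w => f (g w)) z (L * M).
Proof.
move=> dg df e e0.
have [dl dl0 Hl] := cderiv_lip dg.
have [L0 M0] : 0 <= cmod L /\ 0 <= cmod M by split; exact: cmod_ge0.
pose K := cmod M + 1 + cmod L.
have K0 : 0 < K by rewrite /K; lra.
have M10 : 0 < cmod M + 1 by lra.
have eK0 : 0 < e / K by rewrite divr_gt0.
have [d1 d10 H1] := df _ eK0; have [d2 d20 H2] := dg _ eK0.
exists (Num.min (Num.min dl d2) (d1 / (cmod M + 1))).
  by rewrite !lt_min dl0 d20 divr_gt0.
move=> h; rewrite !lt_min => /andP[/andP[/Hl hl /H2 h2] hM].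
have h1 : cmod (g (z + h) - g z) < d1.
  by apply: le_lt_trans hl _; rewrite mulrC -ltr_pdivlMr.
have := H1 _ h1; rewrite (addrC (g z)) subrK => h1'.
rewrite (_ : _ - _ - _ = (f (g (z + h)) - f (g z) - L * (g (z + h) - g z))
   + L * (g (z + h) - g z - M * h)); last by ring.
apply: le_trans (ler_cmodD _ _) _; rewrite cmodM.
have T2 : cmod L * cmod (g (z + h) - g z - M * h) <= cmod L * (e / K * cmod h).
  exact: ler_wpM2l.
have T1 : e / K * cmod (g (z + h) - g z) <= e / K * ((cmod M + 1) * cmod h).
  by rewrite ler_wpM2l// ltW.
apply: le_trans (lerD (le_trans h1' T1) T2) _.
rewrite (_ : _ + _ = (e / K * K) * cmod h); last by rewrite /K; ring.
by rewrite divfK// gt_eqF.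
Qed.

(** A first-order expansion along v identifies the directional derivative; this
    converts complex derivatives into derivatives of real-valued functions. *)
Lemma is_derive_expansion (V : normedModType R) (F : V -> R) (x v : V) (l : R) :
  (forall e, 0 < e -> exists2 d, 0 < d & forall h : R, `|h| < d ->
     `|F (x + h *: v) - F x - l * h| <= e * `|h|) ->
  is_derive x v F l.
Proof.
move=> H.
have cv : (fun h : R => h^-1 *: ((F \o shift x) (h *: v) - F x)) @ 0^' --> l.
  apply/cvgrPdist_le => e e0; have [d d0 Hd] := H _ e0.
  near=> h.
  have h0 : h != 0 by near: h; exact: nbhs_dnbhs_neq.
  have hd : `|h| < d by near: h; apply: dnbhs0_lt.
  rewrite distrC -(ler_pM2r (_ : 0 < `|h|)) ?normr_gt0// -normrM mulrBl.
  have -> : h^-1 *: ((F \o shift x) (h *: v) - F x) * h = F (x + h *: v) - F x.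
    by rewrite /GRing.scale/= mulrAC mulVf// mul1r (addrC x).
  exact: Hd.
by apply: DeriveDef; [apply/cvg_ex; exists l | exact: (cvg_lim _ cv)].
Unshelve. all: by end_near. Qed.

(** Restricted to the real line w + R v, a complex differentiable function has
    derivative L v, which splits into its real and imaginary parts. *)
Lemma cderiv_line g w v t L : cderiv g (w + t%:C%C * v) L ->
  is_derive t 1 (fun s => complex.Re (g (w + s%:C%C * v))) (complex.Re (L * v)) /\
  is_derive t 1 (fun s => complex.Im (g (w + s%:C%C * v))) (complex.Im (L * v)).
Proof.
move=> dg.
have key e : 0 < e -> exists2 d, 0 < d & forall h : R, `|h| < d ->
   cmod (g (w + (t + h *: 1)%:C%C * v) - g (w + t%:C%C * v) - L * v * h%:C%C)
     <= e * `|h|.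
  move=> e0; have v1 : 0 < cmod v + 1 by rewrite ltr_wpDl ?cmod_ge0.
  have [d d0 H] := dg _ (divr_gt0 e0 v1).
  exists (d / (cmod v + 1)); first exact: divr_gt0.
  move=> h; rewrite ltr_pdivlMr// => hd.
  have hv : cmod (v * h%:C%C) <= `|h| * (cmod v + 1).
    by rewrite cmodM cmod_real mulrC ler_wpM2l// lerDl.
  have := H _ (le_lt_trans hv hd).
  rewrite (_ : w + t%:C%C * v + v * h%:C%C = w + (t + h *: 1)%:C%C * v); last first.
    by rewrite /GRing.scale/= mulr1 rmorphD/=; ring.
  rewrite mulrA => /le_trans; apply.
  apply: (@le_trans _ _ (e / (cmod v + 1) * (`|h| * (cmod v + 1)))).
    by rewrite ler_wpM2l// ltW// divr_gt0.
  by rewrite (mulrC `|h|) mulrA divfK ?gt_eqF.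
split; apply: is_derive_expansion => e /key[d d0 H]; exists d => // h /H.
- apply: le_trans; apply: le_trans (ler_Re_cmod _).
  rewrite le_eqVlt; apply/orP; left; apply/eqP; congr (`|_|).
  by case: (L * v) => a b; case: (g _) => ? ?; case: (g _) => ? ? /=; ring.
- apply: le_trans; apply: le_trans (ler_Im_cmod _).
  rewrite le_eqVlt; apply/orP; left; apply/eqP; congr (`|_|).
  by case: (L * v) => a b; case: (g _) => ? ?; case: (g _) => ? ? /=; ring.
Unshelve. all: by end_near. Qed.

End ComplexDerivative.

(** * The complex exponential *)

(** The converse of the previous expansion, over any field of scalars: it is used
    for real functions and for the complex differentiability of f. *)
Lemma is_derive_expansion_of (K : numFieldType) (V W : normedModType K)
    (f : V -> W) (x v : V) (df : W) (e : K) :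
  is_derive x v f df -> 0 < e ->
  exists2 d : K, 0 < d & forall h : K, `|h| < d ->
    `|f (h *: v + x) - f x - h *: df| <= e * `|h|.
Proof.
move=> dfx e0.
have /derivable_nbhs := @ex_derive _ _ _ _ _ _ _ dfx.
rewrite (@derive_val _ _ _ _ _ _ _ dfx) => /eqaddoP /(_ _ e0) /nbhs_ballP[d /= d0 H].
exists d => // h hd.
have := H h; rewrite -ball_normE /= sub0r normrN => /(_ hd).
rewrite /= !fctE opprD addrA; exact.
Qed.

Definition cexp (R : realType) (w : R[i]) : R[i] :=
  (expR (complex.Re w) * cos (complex.Im w)
   +i* (expR (complex.Re w) * sin (complex.Im w)))%C.

Section ComplexExponential.
Variable R : realType.
Implicit Types (z w h : R[i]) (e x t : R).

Lemma cexpD z w : cexp (z + w) = cexp z * cexp w.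
Proof.
case: z w => [a b] [c d]; apply/eqP; rewrite eq_complex /= expRD cosD sinD.
by apply/andP; split; apply/eqP; ring.
Qed.

Lemma cexp0 : cexp (0 : R[i]) = 1.
Proof.
by apply/eqP; rewrite eq_complex /= expR0 cos0 sin0 !mul1r !eqxx.
Qed.

Lemma cexpNM w : cexp w * cexp (- w) = 1.
Proof. by rewrite -cexpD subrr cexp0. Qed.

Lemma cmod_cexp w : cmod (cexp w) = expR (complex.Re w).
Proof.
rewrite cmodE /= !exprMn -mulrDr cos2Dsin2 mulr1 sqrtr_sqr ger0_norm//.
Qed.

Lemma cexp_periodic w : cexp (w + (0 +i* (pi *+ 2))%C) = cexp w :> R[i].
Proof.
rewrite cexpD -[RHS]mulr1; congr (_ * _).
by apply/eqP; rewrite eq_complex /= expR0 cos2pi sin2pi !mul1r !eqxx.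
Qed.

Lemma cderiv_cexp0 : cderiv (@cexp R) 0 1.
Proof.
move=> e e0.
have e8 : 0 < e / 8 by rewrite divr_gt0.
have [d1 d10 H1] := is_derive_expansion_of (is_derive_expR (0 : R)) e8.
have [d2 d20 H2] := is_derive_expansion_of (is_derive_cos (0 : R)) e8.
have [d3 d30 H3] := is_derive_expansion_of (is_derive_sin (0 : R)) e8.
have [d4 d40 H4] := is_derive_expansion_of (is_derive_expR (0 : R)) (@ltr01 R).
exists (Num.min (Num.min (Num.min d1 d2) (Num.min d3 d4)) (Num.min 1 (e / 16))).
  by rewrite !lt_min d10 d20 d30 d40 ltr01 divr_gt0.
case=> s t; set m := cmod (s +i* t)%C.
have sm : `|s| <= m := ler_Re_cmod (s +i* t)%C.
have tm : `|t| <= m := ler_Im_cmod (s +i* t)%C.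
rewrite !lt_min => /andP[/andP[/andP[md1 md2] /andP[md3 md4]] /andP[m1 me]].
have S : `|sin t - t| <= e / 8 * `|t|.
  have := H3 _ (le_lt_trans tm md3).
  by rewrite /GRing.scale/= !mulr1 !addr0 cos0 sin0 mulr1 subr0.
have Cc : `|cos t - 1| <= e / 8 * `|t|.
  have := H2 _ (le_lt_trans tm md2).
  by rewrite /GRing.scale/= !mulr1 !addr0 cos0 sin0 oppr0 mulr0 subr0.
have E1 : `|expR s - 1 - s| <= e / 8 * `|s|.
  have := H1 _ (le_lt_trans sm md1).
  by rewrite /GRing.scale/= !mulr1 !addr0 expR0 mulr1.
have E : `|expR s - 1 - s| <= `|s|.
  have := H4 _ (le_lt_trans sm md4).
  by rewrite /GRing.scale/= !mulr1 !addr0 expR0 mulr1 mul1r.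
have m0 : 0 <= m by exact: cmod_ge0.
rewrite !add0r cexp0 mul1r; apply: le_trans (ler_cmod_ReIm _) _ => /=.
have x2 : `|expR s| <= 3.
  rewrite (_ : expR s = (expR s - 1 - s) + s + 1); last by ring.
  have := ler_normD (expR s - 1 - s + s) 1; have := ler_normD (expR s - 1 - s) s.
  by rewrite normr1; lra.
(* The exponential and trigonometric errors are separated; e / 16 bounds
   |s| in the cross term (expR s - 1) * t. *)
have re : `|expR s * cos t - 1 - s| <= e / 2 * m.
  rewrite (_ : _ - _ - _ = (expR s - 1 - s) + expR s * (cos t - 1)); last by ring.
  apply: le_trans (ler_normD _ _) _; rewrite normrM.
  have : `|expR s| * `|cos t - 1| <= 3 * (e / 8 * `|t|) by rewrite ler_pM.
  have : e / 8 * `|s| <= e / 8 * m by rewrite ler_wpM2l// ltW.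
  have : e / 8 * `|t| <= e / 8 * m by rewrite ler_wpM2l// ltW.
  by lra.
have im : `|expR s * sin t - 0 - t| <= e / 2 * m.
  rewrite (_ : _ - _ - _ = expR s * (sin t - t) + (expR s - 1 - s + s) * t); last by ring.
  apply: le_trans (ler_normD _ _) _; rewrite !normrM.
  have : `|expR s| * `|sin t - t| <= 3 * (e / 8 * `|t|) by rewrite ler_pM.
  have : `|expR s - 1 - s + s| * `|t| <= (`|s| + `|s|) * `|t|.
    by rewrite ler_wpM2r//; apply: le_trans (ler_normD _ _) _; rewrite lerD2r.
  have : (`|s| + `|s|) * `|t| <= (e / 16 + e / 16) * m.
    by rewrite ler_pM// ?addr_ge0//; lra.
  have : e / 8 * `|t| <= e / 8 * m by rewrite ler_wpM2l// ltW.
  have : e * m >= 0 by rewrite mulr_ge0// ltW.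
  by lra.
rewrite (_ : e * m = e / 2 * m + e / 2 * m); last by rewrite -mulrDl -splitr.
by apply: lerD; move: re im; rewrite ?oppr0.
Qed.

Lemma cderiv_cexp w : cderiv (@cexp R) w (cexp w).
Proof.
move=> e e0; have c0 : 0 < cmod (cexp w) by rewrite cmod_cexp expR_gt0.
have [d d0 H] := cderiv_cexp0 (divr_gt0 e0 c0).
exists d => // h /H; rewrite add0r mul1r cexp0.
rewrite cexpD (_ : _ - cexp w - _ = cexp w * (cexp h - 1 - h)); last by ring.
by rewrite cmodM -(ler_pM2l c0) mulrA mulrCA divff ?gt_eqF// mulr1.
Qed.

End ComplexExponential.

(** * Integrals of continuous complex-valued functions *)

Definition rcont (R : realType) (F : R -> R[i]) : Prop :=
  continuous (fun t => complex.Re (F t)) /\ continuous (fun t => complex.Im (F t)).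

Definition rint (R : realType) (a b : R) (f : R -> R) : R :=
  \int[lebesgue_measure]_(t in `[a, b]) f t.

Definition cint (R : realType) (a b : R) (F : R -> R[i]) : R[i] :=
  (rint a b (fun t => complex.Re (F t)) +i* rint a b (fun t => complex.Im (F t)))%C.

Section RealIntegral.
Variable R : realType.
Implicit Types (a b m M c : R) (f g G : R -> R).

Lemma rint_integrable a b f : continuous f ->
  (@lebesgue_measure R).-integrable `[a, b] (EFin \o f).
Proof.
move=> cf; apply: continuous_compact_integrable; first exact: segment_compact.
exact: continuous_subspaceT.
Qed.

Lemma eq_rint a b f g : f =1 g -> rint a b f = rint a b g.
Proof. by move=> fg; apply: eq_Rintegral => t _; exact: fg. Qed.

Lemma rintD a b f g : continuous f -> continuous g ->
  rint a b (fun t => f t + g t) = rint a b f + rint a b g.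
Proof. by move=> cf cg; rewrite /rint RintegralD//; exact: rint_integrable. Qed.

Lemma rintZ a b c f : continuous f ->
  rint a b (fun t => c * f t) = c * rint a b f.
Proof. by move=> cf; rewrite /rint RintegralZl//; exact: rint_integrable. Qed.

Lemma rint_cst a b c : a <= b -> rint a b (fun=> c) = (b - a) * c.
Proof.
move=> ab; rewrite /rint Rintegral_cst// mulrC; congr (_ * _).
apply: etrans (congr1 fine (lebesgue_measure_itv `[a, b])) _; rewrite /= lte_fin.
by case: ltgtP ab => //= -> _; rewrite subrr.
Qed.

Lemma ler_rint a b f g : continuous f -> continuous g ->
  (forall t, a <= t <= b -> f t <= g t) -> rint a b f <= rint a b g.
Proof.
by move=> cf cg fg; apply: le_Rintegral => //; exact: rint_integrable.
Qed.

Lemma rint_cat a m b f : a <= m -> m <= b -> continuous f ->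
  rint a b f = rint a m f + rint m b f.
Proof.
move=> am mb cf; apply/eqP; rewrite addrC -subr_eq; apply/eqP.
rewrite /rint Rintegral_itvB//; last exact: rint_integrable.
apply: Rintegral_itv_obnd_cbnd.
apply: integrableS (rint_integrable m b cf) => //.
exact: subset_itv_oc_cc.
Qed.

Lemma rint_FTC a b f G : a < b -> continuous f ->
  (forall t, is_derive (t : R) (1 : R) G (f t)) -> rint a b f = G b - G a.
Proof.
move=> ab cf dG; rewrite /rint /Rintegral (@continuous_FTC2 _ _ G)//.
- exact: continuous_subspaceT.
- have cG t : {for t, continuous G}.
    exact/differentiable_continuous/derivable1_diffP/ex_derive.
  by split=> [t _||]; [exact: ex_derive | exact/cvg_at_right_filter/cG
    | exact/cvg_at_left_filter/cG].
- by move=> t _; rewrite derive1E derive_val.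
Qed.

End RealIntegral.

Section ComplexIntegral.
Variable R : realType.
Implicit Types (a b m M r : R) (c : R[i]) (F G : R -> R[i]).

Lemma rcont_cst c : rcont (fun=> c : R[i]).
Proof. by split=> t; exact: cvg_cst. Qed.

Lemma rcontD F G : rcont F -> rcont G -> rcont (fun t => F t + G t).
Proof.
move=> [F1 F2] [G1 G2]; split=> t.
- rewrite (_ : (fun _ => _) = (fun t => complex.Re (F t) + complex.Re (G t))).
    by apply: cvgD; [exact: F1 | exact: G1].
  by apply/funext => s; case: (F s) (G s) => ? ? [].
- rewrite (_ : (fun _ => _) = (fun t => complex.Im (F t) + complex.Im (G t))).
    by apply: cvgD; [exact: F2 | exact: G2].
  by apply/funext => s; case: (F s) (G s) => ? ? [].
Qed.

Lemma rcontM F G : rcont F -> rcont G -> rcont (fun t => F t * G t).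
Proof.
move=> [F1 F2] [G1 G2]; split=> t.
- rewrite (_ : (fun _ => _) = (fun t => complex.Re (F t) * complex.Re (G t)
    - complex.Im (F t) * complex.Im (G t))).
    by apply: cvgB; apply: cvgM; [exact: F1 | exact: G1 | exact: F2 | exact: G2].
  by apply/funext => s; case: (F s) (G s) => ? ? [].
- rewrite (_ : (fun _ => _) = (fun t => complex.Re (F t) * complex.Im (G t)
    + complex.Im (F t) * complex.Re (G t))).
    by apply: cvgD; apply: cvgM; [exact: F1 | exact: G2 | exact: F2 | exact: G1].
  by apply/funext => s; case: (F s) (G s) => ? ? [].
Qed.

Lemma rcontZ c F : rcont F -> rcont (fun t => c * F t).
Proof. by move=> cF; apply: rcontM => //; exact: rcont_cst. Qed.

Lemma rcontN F : rcont F -> rcont (fun t => - F t).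
Proof.
by move=> /(rcontZ (-1)); rewrite (_ : (fun _ => _) = (fun t => - F t))//;
  apply/funext => t; rewrite mulN1r.
Qed.

Lemma rcontB F G : rcont F -> rcont G -> rcont (fun t => F t - G t).
Proof. by move=> cF cG; apply: rcontD => //; exact: rcontN. Qed.

Lemma eq_cint a b F G : F =1 G -> cint a b F = cint a b G.
Proof. by move=> FG; congr Complex; apply: eq_rint => t; rewrite FG. Qed.

Lemma cint_cst a b c : a <= b -> cint a b (fun=> c) = (b - a)%:C%C * c.
Proof.
move=> ab; rewrite /cint !rint_cst//; case: c => x y.
by apply/eqP; rewrite eq_complex/= !mul0r subr0 addr0 !eqxx.
Qed.

Lemma cintD a b F G : rcont F -> rcont G ->
  cint a b (fun t => F t + G t) = cint a b F + cint a b G.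
Proof.
move=> [F1 F2] [G1 G2]; apply/eqP; rewrite eq_complex /= -!rintD//.
by apply/andP; split; apply/eqP/eq_rint => t; case: (F t) (G t) => ? ? [].
Qed.

Lemma cintZ a b c F : rcont F -> cint a b (fun t => c * F t) = c * cint a b F.
Proof.
move=> [F1 F2]; case: c => x y.
have cZ k (f : R -> R) : continuous f -> continuous (fun t => k * f t).
  by move=> cf t; apply: cvgM; [exact: cvg_cst | exact: cf].
apply/eqP; rewrite eq_complex /= -mulNr -!rintZ// -!rintD//; try exact: cZ.
by apply/andP; split; apply/eqP/eq_rint => t; case: (F t) => ? ? /=; ring.
Qed.

Lemma cintB a b F G : rcont F -> rcont G ->
  cint a b (fun t => F t - G t) = cint a b F - cint a b G.
Proof.
move=> cF cG; rewrite -(mulN1r (cint a b G)) -cintZ// -cintD//; last exact: rcontZ.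
by apply: eq_cint => t; rewrite mulN1r.
Qed.

Lemma cint_cat a m b F : a <= m -> m <= b -> rcont F ->
  cint a b F = cint a m F + cint m b F.
Proof.
move=> am mb [F1 F2]; apply/eqP; rewrite eq_complex/=.
by rewrite -!(rint_cat am mb)// !eqxx.
Qed.

(** Multiplying by the conjugate of the integral makes the integral real, so
    that only the real part of the integrand has to be estimated. *)
Lemma ler_cmod_cint a b M F : a <= b -> rcont F ->
  (forall t, a <= t <= b -> cmod (F t) <= M) -> cmod (cint a b F) <= (b - a) * M.
Proof.
move=> ab cF FM; set I := cint a b F.
have [I0|I0] := eqVneq (cmod I) 0.
  rewrite I0 mulr_ge0 ?subr_ge0//.
  by apply: le_trans (FM a _); rewrite ?cmod_ge0// lexx.
have Ipos : 0 < cmod I by rewrite lt_neqAle eq_sym I0 cmod_ge0.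
rewrite -(ler_pM2l Ipos).
have cJ : rcont (fun t => (I^*)%C * F t) by exact: rcontZ.
have IE : complex.Re (cint a b (fun t => (I^*)%C * F t)) = cmod I * cmod I.
  rewrite cintZ// -/I cmodE -expr2 sqr_sqrtr ?addr_ge0 ?sqr_ge0//.
  by case: (I) => x y /=; ring.
rewrite -IE /= (_ : cmod I * _ = (b - a) * (cmod I * M)); last by ring.
rewrite -rint_cst//; apply: ler_rint => [||t tab]; first exact: cJ.1.
  by move=> ?; exact: cvg_cst.
apply: le_trans (ler_norm _) _; apply: le_trans (ler_Re_cmod _) _.
rewrite cmodM ler_pM ?cmod_ge0//; last exact: FM.
by rewrite /I !cmodE /= sqrrN.
Qed.

Lemma cint_FTC a b F G : a < b -> rcont F ->
  (forall t, is_derive (t : R) (1 : R) (fun s => complex.Re (G s)) (complex.Re (F t))) ->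
  (forall t, is_derive (t : R) (1 : R) (fun s => complex.Im (G s)) (complex.Im (F t))) ->
  cint a b F = G b - G a.
Proof.
move=> ab [F1 F2] d1 d2; rewrite /cint (rint_FTC ab F1 d1) (rint_FTC ab F2 d2).
by case: (G b) (G a) => ? ? [].
Qed.

End ComplexIntegral.

(** * Goursat's theorem and means over a period *)

Definition holo (R : realType) (q : R[i] -> R[i]) : Prop :=
  forall w, exists L, cderiv q w L.

(** The integral of q over the boundary of [a, a + l] x [c, c + h], up to sign,
    with opposite sides paired: in this form only increments of q occur. *)
Definition rect (R : realType) (q : R[i] -> R[i]) (a c l h : R) : R[i] :=
  cint a (a + l) (fun s => q (s +i* (c + h))%C - q (s +i* c)%C)
  - 'i%C * cint c (c + h) (fun t => q ((a + l) +i* t)%C - q (a +i* t)%C).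

Arguments cmod : simpl never.
Arguments rect : simpl never.

Lemma nested_itv (R : realType) (x l : nat -> R) :
  (forall n, 0 <= l n) -> (forall n, x n <= x n.+1) ->
  (forall n, x n.+1 + l n.+1 <= x n + l n) ->
  exists y, forall n, x n <= y <= x n + l n.
Proof.
move=> l0 xi xd.
have xm m n : (m <= n)%N -> x m <= x n.
  by move=> /subnK <-; elim: (n - m)%N => // k IH; exact: le_trans IH (xi _).
have xM m n : (m <= n)%N -> x n + l n <= x m + l m.
  by move=> /subnK <-; elim: (n - m)%N => // k IH; exact: le_trans (xd _) IH.
have ub n m : x n <= x m + l m.
  apply: le_trans (xm _ _ (leq_maxl n m)) _.
  by apply: le_trans (xM _ _ (leq_maxr n m)); rewrite lerDl.
have hs : has_sup (range x).
  by split; [exists (x 0); exists 0%N | exists (x 0 + l 0) => _ [n _ <-]].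
exists (sup (range x)) => n; apply/andP; split.
  by apply: sup_upper_bound => //; exists n.
by apply: sup_le_ub; [exists (x 0); exists 0%N | move=> _ [m _ <-]].
Qed.

Section Goursat.
Variables (R : realType) (q : R[i] -> R[i]).
Hypothesis hq : holo q.
Implicit Types (a c l h e d s t x y : R).

Lemma rcont_line (w v : R[i]) : rcont (fun t => q (w + t%:C%C * v)).
Proof.
have D t : exists L, is_derive (t : R) (1 : R)
     (fun s => complex.Re (q (w + s%:C%C * v))) (complex.Re (L * v)) /\
  is_derive (t : R) (1 : R) (fun s => complex.Im (q (w + s%:C%C * v))) (complex.Im (L * v)).
  by have [L /cderiv_line ?] := hq (w + t%:C%C * v); exists L.
split=> t; have [L [d1 d2]] := D t.
- by apply/differentiable_continuous/derivable1_diffP; exact: (@ex_derive _ _ _ _ _ _ _ d1).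
- by apply/differentiable_continuous/derivable1_diffP; exact: (@ex_derive _ _ _ _ _ _ _ d2).
Qed.

Lemma rcont_vert s : rcont (fun t => q (s +i* t)%C).
Proof.
rewrite (_ : (fun _ => _) = (fun t => q (s%:C%C + t%:C%C * 'i%C))); first exact: rcont_line.
by apply/funext => t; rewrite [X in q X]complexE /= (mulrC 'i%C).
Qed.

Lemma rcont_horiz t : rcont (fun s => q (s +i* t)%C).
Proof.
rewrite (_ : (fun _ => _) = (fun s => q ((0 +i* t)%C + s%:C%C * 1))); first exact: rcont_line.
by apply/funext => s; rewrite mulr1 addrC; congr q; apply/eqP; rewrite eq_complex/= addr0 add0r !eqxx.
Qed.

Lemma rect_splitl a c l1 l2 h : 0 <= l1 -> 0 <= l2 ->
  rect q a c (l1 + l2) h = rect q a c l1 h + rect q (a + l1) c l2 h.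
Proof.
move=> l10 l20; rewrite /rect addrA (@cint_cat _ a (a + l1)) ?lerDl//; last first.
  by apply: rcontB; exact: rcont_horiz.
rewrite !cintB; try exact: rcont_horiz; try exact: rcont_vert; ring.
Qed.

Lemma rect_splith a c l h1 h2 : 0 <= h1 -> 0 <= h2 ->
  rect q a c l (h1 + h2) = rect q a c l h1 + rect q a (c + h1) l h2.
Proof.
move=> h10 h20; rewrite /rect addrA (@cint_cat _ c (c + h1)) ?lerDl//; last first.
  by apply: rcontB; exact: rcont_vert.
rewrite !cintB; try exact: rcont_horiz; try exact: rcont_vert; ring.
Qed.

(** The boundary integral is additive under halving either side, so by the
    triangle inequality one of the four quarters carries enough of it. *)
Lemma rect_quarter a c l h : 0 <= l -> 0 <= h ->
  exists p : R * R, [/\ a <= p.1 /\ p.1 + l / 2 <= a + l,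
     c <= p.2 /\ p.2 + h / 2 <= c + h &
     cmod (rect q a c l h) <= 4 * cmod (rect q p.1 p.2 (l / 2) (h / 2))].
Proof.
move=> l0 h0; have [l20 h20] : 0 <= l / 2 /\ 0 <= h / 2 by lra.
rewrite [in rect q a c l h](splitr l) [in rect q a c _ h](splitr h).
rewrite rect_splitl// !rect_splith//.
set r1 := rect _ a c _ _; set r2 := rect _ a (_ + _) _ _.
set r3 := rect _ (_ + _) c _ _; set r4 := rect _ (_ + _) (_ + _) _ _.
have B := le_trans (ler_cmodD (r1 + r2) (r3 + r4)) (lerD (ler_cmodD r1 r2) (ler_cmodD r3 r4)).
set T := cmod (r1 + r2 + (r3 + r4)) in B *.
have [t1|t1] := lerP T (4 * cmod r1); first by exists (a, c); do 2?split => //=; lra.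
have [t2|t2] := lerP T (4 * cmod r2); first by exists (a, c + h / 2); do 2?split => //=; lra.
have [t3|t3] := lerP T (4 * cmod r3); first by exists (a + l / 2, c); do 2?split => //=; lra.
by exists (a + l / 2, c + h / 2); do 2?split => //=; lra.
Qed.

(** The affine part of q contributes nothing to the boundary integral, so only
    the differentiability error, of order e times the diameter, remains, on
    sides of total length of the order of the diameter. *)
Lemma rect_small x y e : 0 < e -> exists2 d, 0 < d &
  forall a c l h, 0 <= l -> 0 <= h -> l + h < d ->
    a <= x <= a + l -> c <= y <= c + h ->
    cmod (rect q a c l h) <= 2 * e * (l + h) ^+ 2.
Proof.
move=> e0; have [L /(_ _ e0) [d d0 H]] := hq (x +i* y)%C; exists d => //.
move=> a c l h l0 h0 lhd /andP[ax xal] /andP[cy ych].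
pose E w := q w - q (x +i* y)%C - L * (w - (x +i* y)%C).
have err s t : a <= s <= a + l -> c <= t <= c + h -> cmod (E (s +i* t)%C) <= e * (l + h).
  move=> /andP[as1 as2] /andP[ct1 ct2].
  have dd : cmod ((s +i* t)%C - (x +i* y)%C) <= l + h.
    apply: le_trans (ler_cmod_ReIm _) _; apply: lerD => /=; rewrite ler_norml; lra.
  rewrite /E -{1}(subrKC (x +i* y)%C (s +i* t)%C).
  apply: le_trans (H _ (le_lt_trans dd lhd)) _.
  by rewrite ler_wpM2l// ltW.
have ch s : rcont (fun t => q (s +i* t)%C) by exact: rcont_vert.
have cv t : rcont (fun s => q (s +i* t)%C) by exact: rcont_horiz.
have I1 : cmod (cint a (a + l) (fun s => q (s +i* (c + h))%C - q (s +i* c)%C - L * ('i%C * h%:C%C)))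
    <= (a + l - a) * (2 * (e * (l + h))).
  apply: ler_cmod_cint => [||s sal]; first by rewrite lerDl.
    by apply: rcontB; [exact: rcontB | exact: rcont_cst].
  rewrite (_ : _ - _ = E (s +i* (c + h))%C - E (s +i* c)%C).
    apply: le_trans (ler_cmodB _ _) _.
    by rewrite mulr2n mulrDl mul1r lerD// err// ?lexx ?lerDl ?h0.
  rewrite /E (_ : (s +i* (c + h))%C = (s +i* c)%C + 'i%C * h%:C%C); first ring.
  by apply/eqP; rewrite eq_complex/= !(mul0r,mulr0,mul1r,addr0,subr0,add0r) !eqxx.
have I2 : cmod (cint c (c + h) (fun t => q ((a + l) +i* t)%C - q (a +i* t)%C - L * l%:C%C))
    <= (c + h - c) * (2 * (e * (l + h))).
  apply: ler_cmod_cint => [||s sal]; first by rewrite lerDl.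
    by apply: rcontB; [exact: rcontB | exact: rcont_cst].
  rewrite (_ : _ - _ = E ((a + l) +i* s)%C - E (a +i* s)%C).
    apply: le_trans (ler_cmodB _ _) _.
    by rewrite mulr2n mulrDl mul1r lerD// err// ?lexx ?lerDl ?l0.
  rewrite /E (_ : ((a + l) +i* s)%C = (a +i* s)%C + l%:C%C); first ring.
  by apply/eqP; rewrite eq_complex/= addr0 !eqxx.
have -> : rect q a c l h =
    cint a (a + l) (fun s => q (s +i* (c + h))%C - q (s +i* c)%C - L * ('i%C * h%:C%C))
  - 'i%C * cint c (c + h) (fun t => q ((a + l) +i* t)%C - q (a +i* t)%C - L * l%:C%C).
  rewrite [in RHS]cintB; [|exact: rcontB|exact: rcont_cst].
  rewrite [X in _ = _ - 'i%C * X]cintB; [|exact: rcontB|exact: rcont_cst].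
  rewrite !cint_cst ?lerDl// /rect !(addrC _ l) !(addrC _ h) !addrK; ring.
apply: le_trans (ler_cmodB _ _) _; rewrite cmodM cmod_i mul1r.
apply: le_trans (lerD I1 I2) _.
by rewrite le_eqVlt; apply/orP; left; apply/eqP; ring.
Qed.

(** Goursat's argument: repeated bisection finds nested rectangles of area
    4^-n times the original one whose boundary integrals decay no faster than
    4^-n, while differentiability at the common point makes these integrals
    negligible against the area. *)
Lemma goursat a c l h : 0 <= l -> 0 <= h -> rect q a c l h = 0.
Proof.
move=> l0 h0; apply: cmod_eq0.
pose ln n : R := l / 2 ^+ n; pose hn n : R := h / 2 ^+ n.
have ln0 n : 0 <= ln n by rewrite divr_ge0// exprn_ge0.
have hn0 n : 0 <= hn n by rewrite divr_ge0// exprn_ge0.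
have half (z : R) n : z / 2 ^+ n / 2 = z / 2 ^+ n.+1 by rewrite exprSr invfM mulrA.
have /choice[nx Hnx] : forall np : nat * (R * R), exists p : R * R,
    [/\ np.2.1 <= p.1 /\ p.1 + ln np.1.+1 <= np.2.1 + ln np.1,
     np.2.2 <= p.2 /\ p.2 + hn np.1.+1 <= np.2.2 + hn np.1 &
     cmod (rect q np.2.1 np.2.2 (ln np.1) (hn np.1))
       <= 4 * cmod (rect q p.1 p.2 (ln np.1.+1) (hn np.1.+1))].
  move=> [n p]; have [p'] := rect_quarter p.1 p.2 (ln0 n) (hn0 n).
  by rewrite /ln /hn !half => ?; exists p'.
pose u := fix u n := if n is n'.+1 then nx (n', u n') else (a, c).
have Hu n := Hnx (n, u n).
have [x xP] : exists x, forall n, (u n).1 <= x <= (u n).1 + ln n.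
  by apply: nested_itv => // n; have [[] ] := Hu n.
have [y yP] : exists y, forall n, (u n).2 <= y <= (u n).2 + hn n.
  by apply: nested_itv => // n; have [_ []] := Hu n.
have grow n : cmod (rect q a c l h) <= 4 ^+ n * cmod (rect q (u n).1 (u n).2 (ln n) (hn n)).
  elim: n => [|n IH]; first by rewrite expr0 mul1r /ln /hn !expr0 !divr1.
  apply: le_trans IH _; rewrite exprSr -mulrA ler_wpM2l ?exprn_ge0//.
  by have [_ _] := Hu n.
apply/eqP; rewrite eq_le cmod_ge0 andbT; apply/ler_addgt0Pr => e e0; rewrite add0r.
pose K := 2 * (l + h) ^+ 2 + 1.
have K0 : 0 < K by rewrite ltr_wpDl// mulr_ge0// sqr_ge0.
have [d d0 Hd] := rect_small x y (divr_gt0 e0 K0).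
have [n nP] : exists n, (l + h) / 2 ^+ n < d.
  have [n nP] : exists n : nat, (l + h) / d < n%:R.
    exists (Num.truncn ((l + h) / d)).+1; exact: truncnS_gt.
  exists n; rewrite ltr_pdivrMr ?exprn_gt0// mulrC -ltr_pdivrMr//.
  by apply: lt_le_trans nP _; rewrite -natrX ler_nat ltnW// ltn_expl.
have := Hd (u n).1 (u n).2 (ln n) (hn n) (ln0 n) (hn0 n).
rewrite -mulrDl => /(_ nP (xP n) (yP n)) S.
apply: le_trans (grow n) _.
apply: (@le_trans _ _ (4 ^+ n * (2 * (e / K) * ((l + h) / 2 ^+ n) ^+ 2))).
  by rewrite ler_wpM2l// exprn_ge0.
rewrite (_ : _ * _ = e / K * (2 * (l + h) ^+ 2)); last first.
  rewrite expr_div_n -exprM mulnC exprM (_ : 2 ^+ 2 = 4 :> R) -?natrX//.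
  by field; rewrite ?gt_eqF ?exprn_gt0.
rewrite mulrAC ler_pdivrMr// ler_wpM2l ?ltW// /K; lra.
Qed.

(** The integrals over the two horizontal sides of a period strip cancel, so
    the integral over a vertical period does not depend on its abscissa and
    equals its limit at the left end of the strip. *)
Lemma periodic_mean (L : R[i]) s : (forall w, q (w + (0 +i* (pi *+ 2))%C) = q w) ->
  (forall e, 0 < e -> exists S, forall s t, s <= S -> cmod (q (s +i* t)%C - L) <= e) ->
  cint 0 (pi *+ 2) (fun t => q (s +i* t)%C) = (pi *+ 2)%:C%C * L.
Proof.
move=> per lim; have p0 : 0 <= pi *+ 2 :> R by rewrite mulrn_wge0// pi_ge0.
have indep s' : s' <= s -> cint 0 (pi *+ 2) (fun t => q (s +i* t)%C)
    = cint 0 (pi *+ 2) (fun t => q (s' +i* t)%C).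
  move=> s's; have ss : 0 <= s - s' by rewrite subr_ge0.
  have := goursat s' 0 ss p0; rewrite /rect !add0r subrKC.
  rewrite (@eq_cint _ s' _ _ (fun=> 0)) => [|x]; last first.
    by rewrite -(per (x +i* 0)%C) [(x +i* 0)%C + _](_ : _ = (x +i* (pi *+ 2))%C) ?subrr//;
      apply/eqP; rewrite eq_complex /= addr0 add0r !eqxx.
  rewrite cint_cst// mulr0 sub0r => /eqP; rewrite oppr_eq0 mulf_eq0.
  rewrite [_ == 0]eq_complex /= oner_eq0 andbF/=.
  by rewrite cintB; [rewrite subr_eq0 => /eqP|exact: rcont_vert|exact: rcont_vert].
apply/eqP; rewrite -subr_eq0; apply/eqP/cmod_eq0/eqP.
rewrite eq_le cmod_ge0 andbT; apply/ler_addgt0Pr => e e0; rewrite add0r.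
have e1 : 0 < e / (pi *+ 2 + 1) by rewrite divr_gt0// ltr_wpDl.
have [S HS] := lim _ e1.
rewrite (indep (Num.min s S)) ?ge_min ?lexx// -{2}[pi *+ 2](subr0) -cint_cst// -cintB.
- apply: le_trans (ler_cmod_cint p0 _ (fun t _ => HS _ t _)) _.
  + by apply: rcontB; [exact: rcont_vert | exact: rcont_cst].
  + by rewrite ge_min lexx orbT.
  + by rewrite subr0 mulrCA ler_piMr ?ltW// ltr_pdivrMr ?ltr_wpDl// mul1r ltrDl.
- exact: rcont_vert.
- exact: rcont_cst.
Qed.

End Goursat.

(** * Circle integrals in one variable *)

(** For g holomorphic this is 2 pi r^k times the k-th Taylor coefficient of g at
    0: it is the k-th Fourier coefficient of g on the circle of radius r. *)
Definition coefint (R : realType) (g : R[i] -> R[i]) (r : R) (k : nat) : R[i] :=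
  cint 0 (pi *+ 2)
    (fun t => g (r%:C%C * cexp (0 +i* t)%C) * cexp (- (0 +i* t)%C) ^+ k).

Arguments coefint : simpl never.
Arguments cexp : simpl never.

Section OneVariable.
Variable R : realType.
Implicit Types (g H : R[i] -> R[i]) (w z L : R[i]) (r e M : R) (k : nat).

Lemma two_pi_gt0 : 0 < pi *+ 2 :> R.
Proof. by rewrite pmulrn_lgt0// pi_gt0. Qed.

Lemma cderiv_ext g1 g2 z L1 L2 : g1 =1 g2 -> L1 = L2 -> cderiv g1 z L1 -> cderiv g2 z L2.
Proof. by move=> /funext -> ->. Qed.

Lemma cderiv_cexp_scale (c : R[i]) w :
  cderiv (fun w => c * cexp w) w (c * cexp w).
Proof.
have := cderivM (cderiv_cst c w) (cderiv_cexp w).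
by apply: cderiv_ext => //; rewrite mul0r add0r.
Qed.

Lemma cderiv_cexpNX k w :
  cderiv (fun w => cexp (- w) ^+ k) w (- k%:R * cexp (- w) ^+ k).
Proof.
have d1 : cderiv (fun w => cexp (- w)) w (- cexp (- w)).
  have := cderiv_comp (cderiv_affine (-1) 0 w) (cderiv_cexp (-1 * w + 0)).
  by apply: cderiv_ext => [v|]; rewrite addr0 mulN1r// mulrN1.
elim: k => [|k IH].
  have := cderiv_cst 1 w.
  by apply: cderiv_ext => [v|]; rewrite ?expr0// oppr0 mul0r.
have := cderivM d1 IH; apply: cderiv_ext => [v|]; first by rewrite exprS.
rewrite -natr1 exprS; ring.
Qed.

Lemma cexpN_periodic w : cexp (- (w + (0 +i* (pi *+ 2))%C)) = cexp (- w) :> R[i].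
Proof. by rewrite -(cexp_periodic (- _)) opprD subrK. Qed.

Lemma cmod_cexp_i (t : R) : cmod (cexp (0 +i* t)%C) = 1.
Proof. by rewrite cmod_cexp expR0. Qed.

Lemma cmod_cexpN_i (t : R) k : cmod (cexp (- (0 +i* t)%C) ^+ k) = 1.
Proof.
elim: k => [|k IH]; first by rewrite expr0 cmod1.
by rewrite exprS cmodM IH cmod_cexp /= oppr0 expR0 mulr1.
Qed.

(** The derivative of a periodic function has mean zero over a period. *)
Lemma cint_period H (H' : R[i] -> R[i]) : (forall w, cderiv H w (H' w)) ->
  rcont (fun t => H' (0 +i* t)%C) -> H (0 +i* (pi *+ 2))%C = H 0 ->
  cint 0 (pi *+ 2) (fun t => H' (0 +i* t)%C) = 0.
Proof.
move=> dH cH' per.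
have lineE t : 0 + t%:C%C * 'i%C = (0 +i* t)%C :> R[i].
  by apply/eqP; rewrite add0r eq_complex/= mulr0 !mul0r mulr1 subrr addr0 !eqxx.
have D t := cderiv_line (dH (0 + t%:C%C * 'i%C)).
have := @cint_FTC _ 0 (pi *+ 2) (fun t => H' (0 +i* t)%C * 'i%C)
  (fun t => H (0 + t%:C%C * 'i%C)) two_pi_gt0.
rewrite !lineE per subrr (@eq_cint _ _ _ _ (fun t => 'i%C * H' (0 +i* t)%C)); last first.
  by move=> t; rewrite mulrC.
rewrite cintZ// => I0.
have /eqP : 'i%C * cint 0 (pi *+ 2) (fun t => H' (0 +i* t)%C) = 0.
  apply: I0 => [|t|t].
  - by apply: rcontM => //; exact: rcont_cst.
  - by have [] := D t; rewrite lineE.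
  - by have [] := D t; rewrite lineE.
rewrite mulf_eq0 => /orP[|/eqP//].
by rewrite eq_complex /= oner_eq0 andbF.
Qed.

Lemma rcont_cexp : rcont (fun t : R => cexp (0 +i* t)%C).
Proof. by apply: rcont_vert => w; exists (cexp w); exact: cderiv_cexp. Qed.

Lemma rcont_cexpNX k : rcont (fun t : R => cexp (- (0 +i* t)%C) ^+ k).
Proof.
apply: (@rcont_vert _ (fun w => cexp (- w) ^+ k)) => w.
by exists (- k%:R * cexp (- w) ^+ k); exact: cderiv_cexpNX.
Qed.

Lemma holo_circle g (c : R[i]) : holo g -> holo (fun w => g (c * cexp w)).
Proof.
move=> hg w; have [L dg] := hg (c * cexp w); exists (L * (c * cexp w)).
exact: cderiv_comp (cderiv_cexp_scale c w) dg.
Qed.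

(** The mean value property: w |-> g (e^w) is periodic, and it tends to g 0 at the
    left end of the period strip because e^w tends to 0 there. *)
Lemma coefint0 g r : holo g -> 0 < r -> coefint g r 0 = (pi *+ 2)%:C%C * g 0.
Proof.
move=> hg r0; have hq := holo_circle 1 hg.
rewrite -(@periodic_mean _ _ hq (g 0) (ln r)).
- apply: eq_cint => t; rewrite expr0 mulr1 mul1r; congr g.
  rewrite (_ : (ln r +i* t)%C = (ln r)%:C%C + (0 +i* t)%C); last first.
    by apply/eqP; rewrite eq_complex/= addr0 add0r !eqxx.
  rewrite cexpD; congr (_ * _).
  by apply/eqP; rewrite eq_complex/= lnK// cos0 sin0 mulr1 mulr0 !eqxx.
- by move=> w; rewrite cexp_periodic.
- move=> e e0; have [L /cderiv_lip[d d0 H]] := hg 0.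
  have K0 : 0 < cmod L + 1 by rewrite ltr_wpDl// cmod_ge0.
  have m0 : 0 < Num.min (d / 2) (e / (cmod L + 1)) by rewrite lt_min !divr_gt0.
  exists (ln (Num.min (d / 2) (e / (cmod L + 1)))) => s t sS.
  have : cmod (cexp (s +i* t)%C) <= Num.min (d / 2) (e / (cmod L + 1)).
    by rewrite cmod_cexp/= -[leRHS]lnK// ler_expR.
  rewrite le_min => /andP[cd ce]; rewrite mul1r.
  have := H (cexp (s +i* t)%C); rewrite add0r => h.
  apply: le_trans (h _) _; first by apply: le_lt_trans cd _; rewrite ltr_pdivrMr//; lra.
  by rewrite mulrC -ler_pdivlMr.
Qed.

(** Integration by parts on the circle: the function integrated over a period is
    the derivative of g (r e^w) e^(-(k+1) w). *)
Lemma coefintS g (g' : R[i] -> R[i]) r k : (forall w, cderiv g w (g' w)) ->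
  rcont (fun t => g' (r%:C%C * cexp (0 +i* t)%C)) ->
  k.+1%:R * coefint g r k.+1 = r%:C%C * coefint g' r k.
Proof.
move=> dg cg'.
pose F w := g (r%:C%C * cexp w) * cexp (- w) ^+ k.+1.
pose F' w := r%:C%C * (g' (r%:C%C * cexp w) * cexp (- w) ^+ k)
  - k.+1%:R * (g (r%:C%C * cexp w) * cexp (- w) ^+ k.+1).
have dF w : cderiv F w (F' w).
  have := cderivM (cderiv_comp (cderiv_cexp_scale r%:C%C w) (dg _)) (cderiv_cexpNX k.+1 w).
  apply: cderiv_ext => //; rewrite /F' exprS.
  have := cexpNM w; set a := cexp w; set b := cexp (- w) => ab.
  transitivity (r%:C%C * (g' (r%:C%C * a) * b ^+ k) * (a * b)
    - k.+1%:R * (g (r%:C%C * a) * (b * b ^+ k))); first by ring.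
  by rewrite ab mulr1.
have c1 : rcont (fun t : R => g' (r%:C%C * cexp (0 +i* t)%C) * cexp (- (0 +i* t)%C) ^+ k).
  by apply: rcontM => //; exact: rcont_cexpNX.
have c2 : rcont (fun t : R => g (r%:C%C * cexp (0 +i* t)%C) * cexp (- (0 +i* t)%C) ^+ k.+1).
  apply: rcontM (rcont_cexpNX _).
  apply: (@rcont_vert _ (fun w => g (r%:C%C * cexp w))).
  by apply: holo_circle => w; exists (g' w).
have := cint_period dF; rewrite /F' => I0.
apply/esym/eqP; rewrite -subr_eq0; apply/eqP.
rewrite -cintZ// -cintZ// -cintB//; try exact: rcontZ.
apply: I0; first by apply: rcontB; exact: rcontZ.
have p0 : (0 +i* (pi *+ 2))%C = 0 + (0 +i* (pi *+ 2))%C :> R[i] by rewrite add0r.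
by rewrite p0 /F cexp_periodic cexpN_periodic.
Qed.

Lemma ler_cmod_coefint g r k M : rcont (fun t => g (r%:C%C * cexp (0 +i* t)%C)) ->
  (forall t, cmod (g (r%:C%C * cexp (0 +i* t)%C)) <= M) ->
  cmod (coefint g r k) <= (pi *+ 2) * M.
Proof.
move=> cg gM; rewrite -[X in X * M]subr0; apply: ler_cmod_cint.
- exact: ltW two_pi_gt0.
- by apply: rcontM => //; exact: rcont_cexpNX.
- by move=> t _; rewrite cmodM cmod_cexpN_i mulr1.
Qed.

(** The difference quotient at the centre, composed with exp, is a periodic
    entire function whose limit at the left end is the derivative. *)
Lemma coefint1 g L : holo g -> cderiv g 0 L -> coefint g 1 1 = (pi *+ 2)%:C%C * L.
Proof.
move=> hg dg.
pose q w := (g (1 * cexp w) - g 0) * cexp (- w) ^+ 1.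
have hq : holo q.
  move=> w; have [M dM] := holo_circle 1 hg w.
  exists ((M + 0) * cexp (- w) ^+ 1 + (g (1 * cexp w) - g 0) * (- 1%:R * cexp (- w) ^+ 1)).
  exact: cderivM (cderivD dM (cderiv_cst (- g 0) w)) (cderiv_cexpNX 1 w).
have z0 : cint 0 (pi *+ 2) (fun t : R => g 0 * cexp (- (0 +i* t)%C) ^+ 1) = 0.
  have c1 := rcont_cexpNX 1.
  have := @cint_period (fun w => cexp (- w) ^+ 1) _ (cderiv_cexpNX 1).
  rewrite cintZ// cintZ// => I0; apply/eqP; rewrite mulf_eq0; apply/orP; right.
  have /eqP : - 1%:R * cint 0 (pi *+ 2) (fun t : R => cexp (- (0 +i* t)%C) ^+ 1) = 0.
    apply: I0; first exact: rcontZ.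
    have p0 : (0 +i* (pi *+ 2))%C = 0 + (0 +i* (pi *+ 2))%C :> R[i] by rewrite add0r.
    by rewrite p0 cexpN_periodic.
  by rewrite mulf_eq0 oppr_eq0 oner_eq0.
have c1 : rcont (fun t => g (1 * cexp (0 +i* t)%C) * cexp (- (0 +i* t)%C) ^+ 1).
  apply: rcontM (rcont_cexpNX _).
  by apply: (@rcont_vert _ (fun w => g (1 * cexp w))); exact: holo_circle.
rewrite /coefint -[LHS]subr0 -[X in _ - X]z0 -cintB//; last first.
  by apply: rcontZ; exact: rcont_cexpNX.
rewrite -(@periodic_mean _ _ hq L 0).
- by apply: eq_cint => t; rewrite /q mulrBl.
- by move=> w; rewrite /q cexp_periodic cexpN_periodic.
- move=> e e0; have [d d0 H] := dg _ e0.
  exists (ln (d / 2)) => s t sS; set h := cexp (s +i* t)%C.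
  have hd : cmod h < d.
    rewrite cmod_cexp/=; apply: (@le_lt_trans _ _ (d / 2)); last by lra.
    by rewrite -[leRHS]lnK ?ler_expR// posrE divr_gt0.
  have := H _ hd; rewrite add0r /q mul1r expr1 -/h.
  have hN : h * cexp (- (s +i* t)%C) = 1 by exact: cexpNM.
  have hp : 0 < cmod h by rewrite cmod_cexp expR_gt0.
  rewrite (_ : _ * cexp _ - L = (g h - g 0 - L * h) * cexp (- (s +i* t)%C)); last first.
    by rewrite [RHS]mulrBl -(mulrA L) hN mulr1.
  rewrite -(ler_pM2r hp (cmod (_ * cexp _))) cmodM -mulrA -cmodM (mulrC (cexp _)) hN.
  by rewrite cmod1 mulr1.
Qed.

End OneVariable.

(** * Separately holomorphic functions and Cauchy's formula *)

Definition axis (R : realType) (n : nat) (j : 'I_n) (z : 'rV[R[i]^o]_n) (w : R[i]) :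
    'rV[R[i]^o]_n :=
  z + (w : R[i]^o) *: delta_mx ord0 j.

Definition slice (R : realType) (n : nat) (f : 'rV[R[i]^o]_n -> R[i]^o) (j : 'I_n)
    (z : 'rV[R[i]^o]_n) : R[i] -> R[i] :=
  fun w => f (axis j z w).

(** Joint continuity with holomorphy in each variable is the regularity that
    passes from a function to its Cauchy integrals, hence to its derivatives. *)
Definition sep_holo (R : realType) (n : nat) (f : 'rV[R[i]^o]_n -> R[i]^o) : Prop :=
  continuous f /\ forall j z, exists L, cderiv (slice f j z) 0 L.

(** The complex partial derivative, given by Cauchy's formula on the unit circle:
    it depends on f alone and visibly inherits its regularity in z. *)
Definition cauchyD (R : realType) (n : nat) (j : 'I_n) (f : 'rV[R[i]^o]_n -> R[i]^o) :
    'rV[R[i]^o]_n -> R[i]^o :=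
  fun z => ((pi *+ 2)%:C%C)^-1 * coefint (slice f j z) 1 1.

Section ComplexTopology.
Variable R : realType.

Lemma gtc0_real (e : R[i]) : 0 < e -> exists2 d : R, 0 < d & e = d%:C%C.
Proof.
case: e => a b; rewrite ltcE /= => /andP[/eqP -> a0]; by exists a.
Qed.

Lemma cvg_cmodP (T : Type) (F : set_system T) {FF : Filter F} (g : T -> R[i]^o) (l : R[i]^o) :
  g x @[x --> F] --> l <-> forall e : R, 0 < e -> \forall x \near F, cmod (g x - l) <= e.
Proof.
split=> [/cvgrPdist_le H e e0|H].
  have := H (e%:C%C); rewrite ltcR => /(_ e0); apply: filterS => x.
  by rewrite distrC normC_cmod lecR.
apply/cvgrPdist_le => _ /gtc0_real[e e0 ->]; apply: filterS (H _ e0) => x.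
by rewrite distrC normC_cmod lecR.
Qed.

Lemma rcont_continuous (F : R -> R[i]^o) : continuous F -> rcont F.
Proof.
move=> cF; split=> t; apply/cvgrPdist_le => e e0;
  have /cvg_cmodP /(_ _ e0) := cF t; apply: filterS => x; rewrite distrC; apply: le_trans.
- by rewrite -raddfB; exact: ler_Re_cmod.
- by rewrite -raddfB; exact: ler_Im_cmod.
Qed.

Lemma continuous_rcont (F : R -> R[i]) : rcont F -> continuous (F : R -> R[i]^o).
Proof.
move=> [F1 F2] t; apply/cvg_cmodP => e e0; have e2 : 0 < e / 2 by rewrite divr_gt0.
have /cvgrPdist_le /(_ _ e2) H1 := F1 t; have /cvgrPdist_le /(_ _ e2) H2 := F2 t.
near=> x; apply: le_trans (ler_cmod_ReIm _) _; rewrite !raddfB/= [leRHS]splitr.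
by apply: lerD; rewrite distrC; near: x.
Unshelve. all: by end_near. Qed.

(** The tube lemma: continuity in the parameter is uniform over the compact
    interval of integration. *)
Lemma uniform_near (T : topologicalType) (a b : R) (Psi : R * T -> R[i]^o) (z : T) (e : R) :
  continuous Psi -> 0 < e ->
  \forall y \near z, forall t, a <= t <= b -> cmod (Psi (t, y) - Psi (t, z)) <= e.
Proof.
move=> cPsi e0; have e2 : 0 < e / 2 by rewrite divr_gt0.
have /compact_near_coveringP cpt := @segment_compact R a b.
have := @cpt T (nbhs z) (fun y t => cmod (Psi (t, y) - Psi (t, z)) <= e) _.
move=> near_all; have {near_all} : \forall y \near z,
    `[a, b] `<=` [set t | cmod (Psi (t, y) - Psi (t, z)) <= e].
  apply: near_all => t _.
  have /cvg_cmodP /(_ _ e2) [[U V] /= [Ut Vz] UV] := cPsi (t, z).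
  exists (U, V) => //= -[t' y] [/= Ut' Vy].
  rewrite -(subrKA (Psi (t, z))) [leRHS]splitr; apply: le_trans (ler_cmodD _ _) _.
  apply: lerD; first by exact: (UV (t', y)).
  rewrite -cmodN opprB; apply: (UV (t', z)); split => //=.
  exact: nbhs_singleton.
by apply: filterS => y + t; exact.
Qed.

End ComplexTopology.

Section SeparatelyHolomorphic.
Variables (R : realType) (n : nat).
Local Notation Cn := 'rV[R[i]^o]_n.
Implicit Types (f : Cn -> R[i]^o) (z : Cn) (j k : 'I_n).

Lemma differentiable_sep_holo f : (forall z, differentiable f z) -> sep_holo f.
Proof.
move=> df; split=> [z|j z]; first exact: differentiable_continuous.
have /derivableP D : derivable f z (delta_mx ord0 j) by exact: diff_derivable.
exists ('D_(delta_mx ord0 j) f z) => e e0.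
have ec0 : 0 < (e%:C)%C by rewrite ltcR.
have [_ /gtc0_real[d d0 ->] H] := is_derive_expansion_of D ec0.
exists d => // h hd; have := H h; rewrite normC_cmod ltcR => /(_ hd).
rewrite !normC_cmod -rmorphM lecR /slice /axis add0r scale0r addr0.
by rewrite (addrC z) (mulrC ('D_(delta_mx ord0 j) f z)).
Qed.

Lemma slice_shift f j z w h : slice f j z (w + h) = slice f j (axis j z w) h.
Proof. by rewrite /slice /axis scalerDl addrA. Qed.

Lemma slice_at f j z w L : cderiv (slice f j (axis j z w)) 0 L ->
  cderiv (slice f j z) w L.
Proof.
move=> H e /H[d d0 Hd]; exists d => // h /Hd.
by rewrite add0r -!slice_shift addr0.
Qed.

Lemma holo_slice f j z : sep_holo f -> holo (slice f j z).
Proof.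
by move=> [_ H] w; have [L HL] := H j (axis j z w); exists L; exact: slice_at.
Qed.

Lemma cderiv_cauchyD f j z : sep_holo f -> cderiv (slice f j z) 0 (cauchyD j f z).
Proof.
move=> hf; have [L HL] := hf.2 j z.
rewrite /cauchyD (coefint1 (holo_slice j z hf) HL) mulKf//.
by rewrite eq_complex /= eqxx andbT gt_eqF// two_pi_gt0.
Qed.

Lemma cderiv_slice f j z w : sep_holo f ->
  cderiv (slice f j z) w (slice (cauchyD j f) j z w).
Proof. by move=> hf; apply: slice_at; exact: cderiv_cauchyD. Qed.

Lemma continuous_scale (T : topologicalType) (g : T -> R[i]^o) (v : Cn) :
  continuous g -> continuous (fun t => g t *: v).
Proof. by move=> cg t; apply: cvgZ; [exact: cg | exact: cvg_cst]. Qed.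

Lemma continuous_slice_path (T : topologicalType) (p : T -> Cn) (g : T -> R[i]^o) j :
  continuous p -> continuous g -> continuous (fun t => p t + g t *: (delta_mx ord0 j : Cn)).
Proof.
by move=> cp cg t; apply: cvgD; [exact: cp | exact: continuous_scale].
Qed.

Lemma rcont_slice f j z (g : R -> R[i]) : continuous f -> rcont g ->
  rcont (fun t => slice f j z (g t)).
Proof.
move=> cf cg; apply: rcont_continuous => t.
apply: (@continuous_comp _ _ _ (fun t => z + (g t : R[i]^o) *: (delta_mx ord0 j : Cn)) f);
  last exact: cf.
apply: continuous_slice_path => [x|]; first exact: cvg_cst.
exact: continuous_rcont.
Qed.

Lemma uniform_near_slice f j z (e : R) : continuous f -> 0 < e ->
  \forall y \near z, forall t, 0 <= t <= pi *+ 2 ->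
    cmod (slice f j y (cexp (0 +i* t)%C) - slice f j z (cexp (0 +i* t)%C)) <= e.
Proof.
move=> cf e0.
apply: (@uniform_near R Cn 0 (pi *+ 2)
  (fun ty => slice f j ty.2 (cexp (0 +i* ty.1)%C)) z e _ e0) => p.
apply: (@continuous_comp _ _ _
  (fun ty : R * Cn => ty.2 + (cexp (0 +i* ty.1)%C : R[i]^o) *: (delta_mx ord0 j : Cn)) f);
  last exact: cf.
apply: continuous_slice_path => [q|q]; first exact: cvg_snd.
apply: (@continuous_comp _ _ _ (fst : R * Cn -> R) (fun t => cexp (0 +i* t)%C : R[i]^o));
  first exact: cvg_fst.
exact: (continuous_rcont (rcont_cexp R)).
Qed.

Lemma rcont_circle f j z : continuous f ->
  rcont (fun t => slice f j z (1%:C%C * cexp (0 +i* t)%C) * cexp (- (0 +i* t)%C) ^+ 1).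
Proof.
move=> cf; apply: rcontM (rcont_cexpNX _ 1); apply: rcont_slice => //.
by apply: rcontZ; exact: rcont_cexp.
Qed.

Lemma ler_cmod_twopiV (I : R[i]) (M : R) : cmod I <= (pi *+ 2) * M ->
  cmod (((pi *+ 2)%:C%C)^-1 * I) <= M.
Proof.
have p0 := two_pi_gt0 R.
move=> H; rewrite cmodM (_ : cmod _^-1 = (pi *+ 2)^-1).
  by rewrite mulrC ler_pdivrMr// mulrC.
by rewrite /cmod ComplexField.Normc.normcV -/(cmod _) cmod_real gtr0_norm.
Qed.

Lemma continuous_cauchyD f j : continuous f -> continuous (cauchyD j f).
Proof.
move=> cf z; apply/(@cvg_cmodP _ _ (nbhs z)) => e e0.
apply: filterS (uniform_near_slice j z cf e0) => y H.
rewrite /cauchyD -mulrBr; apply: ler_cmod_twopiV.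
rewrite /coefint -cintB; try exact: rcont_circle.
rewrite -[X in X * _]subr0; apply: ler_cmod_cint => [||t tP].
- exact: ltW (two_pi_gt0 R).
- by apply: rcontB; exact: rcont_circle.
- by rewrite -mulrBl cmodM cmod_cexpN_i mulr1 mul1r; exact: H.
Qed.

(** The mean value inequality on the segment from z to its translate by h along
    the k-th axis: the increment of f w - c w is the integral of its derivative. *)
Lemma slice_mvt f k z (h c : R[i]) (e : R) : sep_holo f ->
  (forall s : R, 0 <= s <= 1 -> cmod (slice (cauchyD k f) k z (s%:C%C * h) - c) <= e) ->
  cmod (slice f k z h - f z - c * h) <= e * cmod h.
Proof.
move=> hf H; have cf := hf.1.
pose G w := slice f k z w - c * w.
pose G' w := slice (cauchyD k f) k z w - c.
have dG w : cderiv G w (G' w).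
  have := cderivD (cderiv_slice k z w hf) (cderiv_affine (- c) 0 w).
  by apply: cderiv_ext => // v; rewrite addr0 mulNr.
have lineE (s : R) : 0 + s%:C%C * h = s%:C%C * h by rewrite add0r.
have cC : rcont (fun s : R => s%:C%C * h).
  apply: rcontM (rcont_cst h).
  by split=> t; [exact: cvg_id | exact: cvg_cst].
have cG' : rcont (fun s : R => G' (s%:C%C * h) * h).
  apply: rcontM (rcont_cst h); apply: rcontB (rcont_cst c).
  by apply: rcont_slice => //; exact: continuous_cauchyD.
have I : cint 0 1 (fun s : R => G' (s%:C%C * h) * h)
    = G (0 + 1%:C%C * h) - G (0 + 0%:C%C * h).
  apply: (@cint_FTC _ 0 1 _ (fun s : R => G (0 + s%:C%C * h)) ltr01 cG') => t.
  - by have := (cderiv_line (dG (0 + t%:C%C * h))).1; rewrite lineE.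
  - by have := (cderiv_line (dG (0 + t%:C%C * h))).2; rewrite lineE.
have -> : slice f k z h - f z - c * h
    = cint 0 1 (fun s : R => G' (s%:C%C * h) * h).
  rewrite I /G !lineE !mul0r mul1r mulr0 subr0 /slice /axis scale0r addr0; ring.
rewrite -[leRHS]mul1r -[X in X * _](subr0 (1 : R)); apply: ler_cmod_cint => // s sP.
by rewrite cmodM ler_wpM2r ?cmod_ge0// H.
Qed.

(** Differentiation under the integral sign: continuity of the derivative in the
    k-th variable, uniform over the circle in the j-th one, makes the error of
    the first-order expansion uniform as well. *)
Lemma cderiv_slice_cauchyD f j k z : sep_holo f ->
  cderiv (slice (cauchyD j f) k z) 0 (cauchyD j (cauchyD k f) z).
Proof.
move=> hf e e0; have cD := @continuous_cauchyD f k hf.1.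
have ax : axis k z (w : R[i]^o) @[w --> (0 : R[i]^o)] --> z.
  rewrite -[X in _ --> X](_ : axis k z 0 = z); last by rewrite /axis scale0r addr0.
  apply: (@continuous_slice_path R[i]^o (fun=> z) idfun k); first exact: cst_continuous.
  by move=> w; exact: cvg_id.
have /nbhs_ballP[_ /= /gtc0_real[d d0 ->] Hd] := ax _ (uniform_near_slice j z cD e0).
exists d => // h hd; rewrite add0r.
have p0 := two_pi_gt0 R.
pose v t : R[i] := cexp (0 +i* t)%C.
pose u t : R[i] := cexp (- (0 +i* t)%C) ^+ 1.
have swap (g : Cn -> R[i]^o) t w : slice g j (axis k z w) t = slice g k (axis j z t) w.
  by rewrite /slice /axis addrAC.
have c1 y (g : Cn -> R[i]^o) : continuous g -> rcont (fun t => slice g j y (1%:C%C * v t) * u t).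
  exact: rcont_circle.
set g := cauchyD k f in cD Hd *.
rewrite /slice /axis scale0r addr0 -/(axis k z h) /cauchyD -mulrA -!mulrBr.
apply: ler_cmod_twopiV.
rewrite (mulrC _ h) /coefint -cintZ; last exact: c1.
rewrite -cintB; [|exact: c1 hf.1|exact: c1 hf.1].
rewrite -cintB; [|by apply: rcontB; exact: c1 hf.1|by apply: rcontZ; exact: c1].
rewrite -[X in X * _]subr0; apply: ler_cmod_cint => [||t tP].
- exact: ltW p0.
- apply: rcontB; first by apply: rcontB; exact: c1 hf.1.
  by apply: rcontZ; exact: c1.
rewrite !mul1r -/(v t) -/(u t).
rewrite (_ : _ - _ = (slice f k (axis j z (v t)) h - f (axis j z (v t))
    - slice g j z (v t) * h) * u t); last first.
  by rewrite swap; rewrite /slice; ring.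
rewrite cmodM cmod_cexpN_i mulr1; apply: slice_mvt => // s /andP[s0 s1].
rewrite -swap; apply: Hd => //; rewrite -ball_normE /= sub0r normrN normC_cmod ltcR.
rewrite cmodM cmod_real ger0_norm//; apply: le_lt_trans hd.
by rewrite ler_piMl ?cmod_ge0.
Qed.

Lemma sep_holo_cauchyD f j : sep_holo f -> sep_holo (cauchyD j f).
Proof.
move=> hf; split; first exact: (@continuous_cauchyD _ _ hf.1).
by move=> k z; exists (cauchyD j (cauchyD k f) z); exact: cderiv_slice_cauchyD.
Qed.

Lemma sep_holo_iter f j m : sep_holo f -> sep_holo (iter m (cauchyD j) f).
Proof. by move=> hf; elim: m => //= m; exact: sep_holo_cauchyD. Qed.

(** Cauchy's formula for derivatives of every order, by induction on the order: the
    base case is the mean value property, the step integration by parts. *)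
Lemma coefint_iter f j z r m : sep_holo f -> 0 < r ->
  m`!%:R * coefint (slice f j z) r m
    = (pi *+ 2 * r ^+ m)%:C%C * iter m (cauchyD j) f z.
Proof.
move=> + r0; elim: m f => [|m IH] f hf.
  rewrite fact0 mul1r expr0 mulr1 /= (coefint0 (holo_slice j z hf) r0).
  by rewrite /slice /axis scale0r addr0.
rewrite factS mulnC natrM -mulrA (@coefintS _ _ (slice (cauchyD j f) j z)).
- rewrite mulrCA IH; last exact: sep_holo_cauchyD.
  by rewrite -iterSr mulrA -rmorphM (mulrCA r) -exprS.
- by move=> w; exact: cderiv_slice.
- apply: rcont_slice; first exact: (@continuous_cauchyD _ _ hf.1).
  by apply: rcontZ; exact: rcont_cexp.
Qed.

Lemma cauchy_estimate f j z r m M : sep_holo f -> 0 < r ->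
  (forall w, cmod w = r -> cmod (slice f j z w) <= M) ->
  cmod (iter m (cauchyD j) f z) <= m`!%:R / r ^+ m * M.
Proof.
move=> hf r0 HM; have E := coefint_iter j z m hf r0.
have p0 := two_pi_gt0 R; have rm0 : 0 < r ^+ m by rewrite exprn_gt0.
have pr0 : 0 < pi *+ 2 * r ^+ m by rewrite mulr_gt0.
rewrite -(ler_pM2l pr0) -[X in X * cmod _]gtr0_norm// -cmod_real -cmodM -E cmodM.
have -> : cmod (m`!%:R : R[i]) = m`!%:R.
  by rewrite -(rmorph_nat (real_complex R)) cmod_real ger0_norm.
have -> : pi *+ 2 * r ^+ m * (m`!%:R / r ^+ m * M) = m`!%:R * (pi *+ 2 * M).
  by field; rewrite gt_eqF.
rewrite ler_wpM2l//; apply: ler_cmod_coefint.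
- by apply: rcont_slice hf.1 _; apply: rcontZ; exact: rcont_cexp.
- by move=> t; apply: HM; rewrite cmodM cmod_cexp_i mulr1 cmod_real gtr0_norm.
Qed.

End SeparatelyHolomorphic.

(** * Restriction to the real subspace and polydisc estimates *)

Section Restriction.
Variables (R : realType) (n : nat).
Local Notation Cn := 'rV[R[i]^o]_n.
Local Notation Rn := 'rV[R]_n.
Implicit Types (f : Cn -> R[i]^o) (x : Rn) (z : Cn) (i j : 'I_n) (s : seq 'I_n).

Lemma to_cvec_axis x i (h : R) :
  to_cvec (x + h *: delta_mx ord0 i) = axis i (to_cvec x) h%:C%C.
Proof.
by apply/rowP => k; rewrite !mxE /= rmorphD/= rmorphM/= rmorph_nat.
Qed.

Lemma is_derive_restrict f x i : sep_holo f ->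
  is_derive x (delta_mx ord0 i) (fun y => complex.Re (restrict_real f y))
    (complex.Re (cauchyD i f (to_cvec x))) /\
  is_derive x (delta_mx ord0 i) (fun y => complex.Im (restrict_real f y))
    (complex.Im (cauchyD i f (to_cvec x))).
Proof.
move=> hf; have D := cderiv_cauchyD i (to_cvec x) hf.
have key e : 0 < e -> exists2 d, 0 < d & forall h : R, `|h| < d ->
    cmod (f (to_cvec (x + h *: delta_mx ord0 i)) - f (to_cvec x)
      - cauchyD i f (to_cvec x) * h%:C%C) <= e * `|h|.
  move=> /D[d d0 H]; exists d => // h hd.
  have := H h%:C%C; rewrite cmod_real add0r => /(_ hd).
  by rewrite to_cvec_axis {2}/slice /axis scale0r addr0.
split; apply: is_derive_expansion => e /key[d d0 H]; exists d => // h /H; rewrite /restrict_real.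
- apply: le_trans; apply: le_trans (ler_Re_cmod _).
  rewrite le_eqVlt; apply/orP; left; apply/eqP; congr (`|_|).
  by case: (cauchyD _ _ _) => a b; case: (f _) => ? ?; case: (f _) => ? ? /=; ring.
- apply: le_trans; apply: le_trans (ler_Im_cmod _).
  rewrite le_eqVlt; apply/orP; left; apply/eqP; congr (`|_|).
  by case: (cauchyD _ _ _) => a b; case: (f _) => ? ?; case: (f _) => ? ? /=; ring.
Qed.

Lemma partial_restrict f i : sep_holo f ->
  partial i (restrict_real f) = restrict_real (cauchyD i f).
Proof.
move=> hf; apply/funext => x; have [d1 d2] := is_derive_restrict x i hf.
rewrite /partial (@derive_val _ _ _ _ _ _ _ d1) (@derive_val _ _ _ _ _ _ _ d2).
by rewrite /restrict_real; case: (cauchyD _ _ _).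
Qed.

Lemma has_partial_restrict f i x : sep_holo f -> has_partial i (restrict_real f) x.
Proof.
by move=> hf; have [d1 d2] := is_derive_restrict x i hf; split; exact: ex_derive.
Qed.

Lemma sep_holo_foldr f s : sep_holo f -> sep_holo (foldr (@cauchyD R n) f s).
Proof. by move=> hf; elim: s => //= i s; exact: sep_holo_cauchyD. Qed.

Lemma foldr_partial_restrict f s : sep_holo f ->
  foldr (@partial R n) (restrict_real f) s = restrict_real (foldr (@cauchyD R n) f s).
Proof.
by move=> hf; elim: s => //= i s ->; rewrite partial_restrict//; exact: sep_holo_foldr.
Qed.

Lemma continuous_to_cvec : continuous (@to_cvec R n : Rn -> Cn).
Proof.
have -> : (@to_cvec R n : Rn -> Cn)
    = (fun x => \sum_i ((x ord0 i)%:C%C : R[i]^o) *: (delta_mx ord0 i : Cn)).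
  by apply/funext => x; rewrite [LHS]row_sum_delta; apply: eq_bigr => i _; rewrite mxE.
apply: continuous_big => [|i _]; first exact: add_continuous.
apply: continuous_scale => x.
apply: (@continuous_comp _ _ _ (fun x : Rn => x ord0 i) (fun t : R => t%:C%C : R[i]^o)).
  exact: coord_continuous.
by apply: continuous_rcont; split=> t; [exact: cvg_id | exact: cvg_cst].
Qed.

Lemma smooth_restrict f : sep_holo f -> smooth (restrict_real f).
Proof.
move=> hf s; have hs := sep_holo_foldr s hf; rewrite foldr_partial_restrict//; split.
- move=> x; apply: (@continuous_comp _ _ _ (@to_cvec R n : Rn -> Cn)); last exact: hs.1.
  exact: continuous_to_cvec.
- by move=> i x; exact: has_partial_restrict.
Qed.

(** The complex counterpart of Dalpha, with the list of variables still to be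
    differentiated left free for induction. *)
Definition cauchyDalpha (alpha : 'I_n -> nat) f s : Cn -> R[i]^o :=
  foldr (fun i h => iter (alpha i) (cauchyD i) h) f s.

Lemma sep_holo_Dalpha alpha f s : sep_holo f -> sep_holo (cauchyDalpha alpha f s).
Proof. by move=> hf; elim: s => //= i s; exact: sep_holo_iter. Qed.

Lemma Dalpha_restrict alpha f : sep_holo f ->
  Dalpha alpha (restrict_real f) = restrict_real (cauchyDalpha alpha f (enum 'I_n)).
Proof.
move=> hf; rewrite /Dalpha /cauchyDalpha; elim: (enum _) => //= i s ->.
have hs := sep_holo_Dalpha alpha s hf; rewrite -/(cauchyDalpha alpha f s).
by elim: (alpha i) => //= m ->; rewrite partial_restrict//; exact: sep_holo_iter.
Qed.

(** Cauchy's estimate, one variable after the other: the variables outside s stay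
    at the centre, which is why the radius is 0 there. *)
Lemma polydisc_estimate alpha f s z (r : 'I_n -> R) (M : R) : sep_holo f -> uniq s ->
  (forall i, 0 < r i) ->
  (forall w : Cn, (forall l, cmod (w ord0 l - z ord0 l) <= if l \in s then r l else 0) ->
     cmod (f w) <= M) ->
  cmod (cauchyDalpha alpha f s z)
    <= (\prod_(i <- s) ((alpha i)`!%:R / r i ^+ alpha i)) * M.
Proof.
move=> hf + r0; elim: s z => [|i s IH] z /=.
  move=> _ H; rewrite big_nil mul1r; apply: H => l.
  by rewrite subrr cmod0.
move=> /andP[iNs us] H; rewrite big_cons -mulrA.
apply: cauchy_estimate => [||w wr]; [exact: sep_holo_Dalpha | exact: r0|].
apply: IH => // w' w'P; apply: H => l; have := w'P l.
rewrite /axis !mxE /= inE; have [->|li] := eqVneq l i; last by rewrite /= mulr0 addr0.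
rewrite /= (negPf iNs) mulr1 => wl; rewrite -wr.
have /eqP : cmod (w' ord0 i - (z ord0 i + w)) = 0.
  by apply/eqP; rewrite eq_le wl cmod_ge0.
by move=> /eqP/cmod_eq0/eqP; rewrite subr_eq0 => /eqP ->; rewrite addrC addKr.
Qed.

End Restriction.

(** * Weights and conjugates *)

Section Weights.
Variables (R : realType) (n : nat).
Local Notation Cn := 'rV[R[i]^o]_n.
Local Notation Rn := 'rV[R]_n.

(** The monotonicity of class A concerns one variable at a time, so the
    coordinates are raised from a to b one by one. *)
Lemma class_A_le (g : Rn -> R) (a b : Rn) : class_A g ->
  (forall i, 0 <= a ord0 i <= b ord0 i) -> g a <= g b.
Proof.
move=> [_ _ mono _] ab.
pose w k : Rn := \row_i (if (i < k)%N then b ord0 i else a ord0 i).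
have -> : b = w n by apply/rowP => i; rewrite mxE ltn_ord.
have step k : (k <= n)%N -> g a <= g (w k).
  elim: k => [_|k IH kn].
    by rewrite (_ : w 0%N = a)//; apply/rowP => i; rewrite mxE ltn0.
  apply: le_trans (IH (ltnW kn)) _; apply: (mono (Ordinal kn)) => [j|j jk|].
  - by have /andP[a0 abj] := ab j; rewrite mxE; case: ifP => // _; exact: le_trans abj.
  - rewrite !mxE ltnS leq_eqVlt; case: eqP => //= jk'.
    by move: jk; rewrite (_ : j = Ordinal kn) ?eqxx//; exact: val_inj.
  - by rewrite !mxE /= ltnn ltnSn; have /andP[] := ab (Ordinal kn).
exact: step.
Qed.

Lemma enorm_ge0 (x : Rn) : 0 <= enorm x.
Proof. exact: sqrtr_ge0. Qed.

Lemma cnorm_ge0 (z : Cn) : 0 <= cnorm z.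
Proof. exact: sqrtr_ge0. Qed.

(** Each |x_l| is at most |w_l| + r_l; squaring with (a + b)^2 <= 2 a^2 + 2 b^2
    avoids the triangle inequality for the Euclidean norm, at the cost of the
    harmless factor 2. *)
Lemma enorm_polydisc (x r : Rn) (w : Cn) :
  (forall l, cmod (w ord0 l - to_cvec x ord0 l) <= r ord0 l) ->
  1 + enorm x <= 2 * ((1 + cnorm w) * (1 + enorm r)).
Proof.
move=> H; have e0 := enorm_ge0 r; have c0 := cnorm_ge0 w.
have rw0 := mulr_ge0 c0 e0.
suff : enorm x <= 2 * (cnorm w + enorm r) by nra.
rewrite -(@ler_pXn2r _ 2)// ?nnegrE ?mulr_ge0 ?addr_ge0 ?enorm_ge0//.
have sq (v : 'I_n -> R) : Num.sqrt (\sum_i v i ^+ 2) ^+ 2 = \sum_i v i ^+ 2.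
  by rewrite sqr_sqrtr// sumr_ge0// => i _; exact: sqr_ge0.
have : enorm x ^+ 2 <= 2 * cnorm w ^+ 2 + 2 * enorm r ^+ 2.
  rewrite /enorm /cnorm !sq !mulr_sumr -big_split/=; apply: ler_sum => l _.
  have Hl := H l; have r0 := le_trans (cmod_ge0 _) Hl.
  have w0 := cmod_ge0 (w ord0 l).
  have : `|x ord0 l| <= cmod (w ord0 l) + `|r ord0 l|.
    rewrite (ger0_norm r0) -cmod_real.
    have := ler_cmodB (w ord0 l) (w ord0 l - to_cvec x ord0 l).
    by rewrite mxE subKr => /le_trans; apply; rewrite lerD2l; move: Hl; rewrite mxE.
  move: (normr_ge0 (x ord0 l)) (normr_ge0 (r ord0 l)).
  move: w0; move: `|x ord0 l| `|r ord0 l| (cmod _) => A B D D0 A0 B0 ADB.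
  have := ler_pM A0 A0 ADB ADB; have := sqr_ge0 (D - B); rewrite !expr2; lra.
move=> /le_trans; apply.
have := sqr_ge0 (cnorm w - enorm r); have := mulr_ge0 c0 e0.
by have := sqr_ge0 (cnorm w + enorm r); rewrite !expr2; lra.
Qed.

Lemma p_norm_bound (phi : Rn -> R) m (f : Cn -> R[i]^o) : (p_norm phi m f < +oo)%E ->
  exists2 P : R, 0 < P &
    forall z, cmod (f z) * (1 + cnorm z) ^+ m <= P * expR (phi (imv z)).
Proof.
move=> Hp; set s := p_norm phi m f in Hp.
have ub z : ((cmod (f z) * (1 + cnorm z) ^+ m / expR (phi (imv z)))%:E <= s)%E.
  by apply: ereal_sup_ubound; exists z.
have sfin : s \is a fin_num.
  by rewrite fin_numElt Hp andbT; apply: lt_le_trans (ub 0); exact: ltNyr.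
exists (Num.max (fine s) 1) => [|z]; first by rewrite lt_max ltr01 orbT.
have := ub z; rewrite -(fineK sfin) lee_fin ler_pdivrMr ?expR_gt0//.
by move=> /le_trans; apply; rewrite ler_wpM2r ?expR_ge0// le_max lexx.
Qed.

(** A conjugate is a supremum, so bounds by exp (- (<a, y> - g y)) valid for
    every y combine into a bound by exp (- g^*(a)). *)
Lemma young_fenchel_bound (g : Rn -> R) (a : Rn) (A B K : R) :
  0 <= A -> 0 < B -> 0 < K ->
  (forall y, A <= K * (B * expR (- (dotp a y - g y)))) ->
  (A%:E / (B%:E * expeR (- young_fenchel (fun x => (g x)%:E) a)) <= K%:E)%E.
Proof.
move=> A0 B0 K0 H.
(* For A > 0 the bounds force g^*(a) to be finite, so that the division is
   the real one; an infinite conjugate would force A = 0. *)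
have [A0'|An0] := eqVneq A 0.
  by rewrite A0' mul0e lee_fin ltW.
have Apos : 0 < A by rewrite lt_neqAle eq_sym An0.
pose b := ln (K * B / A).
have KBA : 0 < K * B / A by rewrite divr_gt0// mulr_gt0.
set h := young_fenchel _ a.
have hb : (h <= b%:E)%E.
  apply: ge_ereal_sup => _ [y _ <-]; rewrite -EFinB lee_fin -ler_expR lnK//.
  rewrite ler_pdivlMr// mulrC -ler_pdivlMr ?expR_gt0// -expRN -mulrA; exact: H.
have hN : (-oo < h)%E.
  apply: (@lt_le_trans _ _ ((dotp a 0)%:E - (g 0)%:E)%E); first exact: ltNyr.
  by apply: ereal_sup_ubound; exists 0.
case: h hb hN => [c| |] //; rewrite lee_fin => cb _ /=.
rewrite -EFinM inver mulf_eq0 !gt_eqF ?expR_gt0//= -EFinM lee_fin.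
rewrite ler_pdivrMr ?mulr_gt0 ?expR_gt0// expRN mulrA ler_pdivlMr ?expR_gt0//.
by rewrite mulrC -ler_pdivlMr// -[leRHS]lnK// ler_expR.
Qed.

End Weights.

(** * Restrictions of functions in E(Phi) *)

Lemma prod_cauchy_weights (R : realType) (n : nat) (alpha : 'I_n -> nat) (y : 'rV[R]_n) :
  \prod_(i <- enum 'I_n) ((alpha i)`!%:R / expR (y ord0 i) ^+ alpha i)
    = (mfact alpha)%:R * expR (- dotp (mvec R alpha) y).
Proof.
rewrite big_enum /= big_split /= -natr_prod; congr (_ * _).
rewrite /dotp -sumrN expR_sum; apply: eq_bigr => i _.
by rewrite mxE expRN expRM_natl.
Qed.

Theorem theorem1 (R : realType) (n : nat) (hn : (1 <= n)%N)
    (phi : nat -> 'rV[R]_n -> R)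
    (hphi : forall nu : nat, (1 <= nu)%N -> class_A (phi nu))
    (hgrowth : forall nu : nat, (1 <= nu)%N -> forall A : R, 0 < A ->
       exists2 C : R, 0 < C & forall x : 'rV[R]_n,
         phi nu x + A * ln (1 + enorm x) <= phi nu.+1 x + C) :
  forall f : 'rV[R[i]^o]_n -> R[i]^o,
    E_Phi phi f -> calE_Psi phi (restrict_real f).
Proof.
move=> f [nu /= nu1 [ef pf]]; exists nu.+1 => //.
have hf := differentiable_sep_holo ef.
split=> [|m]; first exact: smooth_restrict.
have [P P0 HP] := p_norm_bound (pf m).
(* The exponent m.+1 rather than m keeps the parameter of the growth
   hypothesis positive when m = 0. *)
have [C C0 HC] := hgrowth nu nu1 m.+1%:R (ltr0Sn _ _).
pose K := P * 2 ^+ m * expR C.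
have K0 : 0 < K by rewrite !mulr_gt0 ?exprn_gt0 ?expR_gt0.
apply: le_lt_trans (ltry K); apply: ge_ereal_sup => _ [[x alpha] _ <-] /=.
have ex1 : 0 < 1 + enorm x by rewrite ltr_wpDr// enorm_ge0.
apply: young_fenchel_bound => // [||y].
- by rewrite mulr_ge0 ?cmod_ge0// exprn_ge0// ltW.
- by rewrite ltr0n prodn_gt0// => i; exact: fact_gt0.
pose r : 'rV[R]_n := \row_i expR (y ord0 i).
have er1 : 0 < 1 + enorm r by rewrite ltr_wpDr// enorm_ge0.
have absorb : expR (phi nu r) * (1 + enorm r) ^+ m <= expR C * expR (phi nu.+1 r).
  have e1 : 1 <= 1 + enorm r by rewrite lerDl enorm_ge0.
  apply: (@le_trans _ _ (expR (phi nu r) * (1 + enorm r) ^+ m.+1)).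
    by rewrite ler_wpM2l ?expR_ge0// ler_weXn2l.
  rewrite -[X in X ^+ _]lnK// -expRM_natl -!expRD ler_expR [leRHS]addrC.
  exact: HC.
have bound (w : 'rV[R[i]^o]_n) :
    (forall l, cmod (w ord0 l - to_cvec x ord0 l)
       <= if l \in enum 'I_n then expR (y ord0 l) else 0) ->
    cmod (f w) <= K * expR (phi nu.+1 r) / (1 + enorm x) ^+ m.
  move=> Hw; have {}Hw l : cmod (w ord0 l - to_cvec x ord0 l) <= r ord0 l.
    by have := Hw l; rewrite mem_enum [r ord0 l]mxE.
  have imw : phi nu (imv w) <= phi nu r.
    have [_ abs _ _] := hphi _ nu1; rewrite abs; apply: class_A_le (hphi _ nu1) _ => l.
    rewrite !mxE normr_ge0 /=; have := Hw l; rewrite !mxE; apply: le_trans.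
    apply: le_trans (ler_Im_cmod _).
    by rewrite (_ : complex.Im (_ - _) = complex.Im (w ord0 l))//; case: (w _ _) => ? ? /=;
      rewrite oppr0 addr0.
  rewrite ler_pdivlMr ?exprn_gt0//.
  have W := enorm_polydisc Hw.
  apply: (@le_trans _ _ (cmod (f w) * (2 * ((1 + cnorm w) * (1 + enorm r))) ^+ m)).
    rewrite ler_wpM2l ?cmod_ge0//; apply: lerXn2r => //; rewrite nnegrE.
    + exact: ltW.
    + exact: ltW (lt_le_trans ex1 W).
  rewrite !exprMn; set c := (1 + cnorm w) ^+ m; set d := (1 + enorm r) ^+ m.
  have fw : cmod (f w) * c <= P * expR (phi nu r).
    by apply: le_trans (HP w) _; rewrite ler_wpM2l ?(ltW P0)// ler_expR.
  have d0 : 0 <= d by rewrite exprn_ge0// ltW.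
  rewrite (_ : _ * _ = 2 ^+ m * (cmod (f w) * c * d)); last by ring.
  rewrite (_ : K * _ = 2 ^+ m * (P * (expR C * expR (phi nu.+1 r)))); last by rewrite /K; ring.
  rewrite ler_wpM2l ?exprn_ge0//; apply: le_trans (ler_wpM2r d0 fw) _.
  by rewrite -mulrA ler_wpM2l// ltW.
rewrite (Dalpha_restrict alpha hf) /restrict_real.
have := polydisc_estimate alpha hf (enum_uniq 'I_n) (fun i => expR_gt0 (y ord0 i)) bound.
rewrite prod_cauchy_weights => est.
rewrite -ler_pdivlMl ?exprn_gt0//; apply: le_trans est _.
rewrite opprB expRD -/(comp_exp _ _) expRN.
rewrite le_eqVlt; apply/orP; left; apply/eqP.
rewrite (_ : comp_exp (phi nu.+1) y = phi nu.+1 r)//.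
by field; rewrite ?gt_eqF ?exprn_gt0 ?expR_gt0.
Qed.
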